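(* Up to isomorphism and trivial equivalences, there are exactly seven 3-cell templates $\mathcal{C}$ (alias Thom-Smale complexes of Sturm 3-ball global attractors) whose underlying cell complex is the solid cube. In terms of the pole distance $\delta$ and the smaller-hemisphere face count $\eta$, these are: three with $(\delta,\eta)=(1,1)$, two with $(\delta,\eta)=(2,1)$, one with $(\delta,\eta)=(2,2)$, and one with $(\delta,\eta)=(3,3)$.
   Context: A finite regular CW-complex $\mathcal{C}=\bigcup_{v\in\mathcal{E}}c_v$ is a finite disjoint union of open cells $c_v$, labeled by barycenters $v\in\mathcal{E}$, whose characteristic maps $\overline{B}_v\to\overline{c}_v$ are homeomorphisms (including on the boundary) and such that each boundary $\partial c_v$ is a subcomplex of the skeleton of lower dimension. Cells of dimension 0, 1, 2 are called vertices, edges, faces. A bipolar orientation of the 1-skeleton is an orientation of all edges without directed cycles and with exactly one ''source'' vertex $\mathbf{N}$ (North pole) and exactly one ''sink'' vertex $\mathbf{S}$ (South pole). A finite regular cell complex $\mathcal{C}$ is called a 3-cell template if all of the following hold. (i) $\mathcal{C}=\mathrm{clos}\,c_{\mathcal{O}}=S^2\,\dot\cup\,c_{\mathcal{O}}$ is the closure of a single 3-cell $c_{\mathcal{O}}$. (ii) The 1-skeleton $\mathcal{C}^1$ carries a bipolar orientation from a pole vertex $\mathbf{N}$ to a pole vertex $\mathbf{S}$, with two directed meridian paths $\mathbf{WE}$ and $\mathbf{EW}$ from $\mathbf{N}$ to $\mathbf{S}$, disjoint except for the poles. The meridians decompose the boundary sphere $S^2=\partial c_{\mathcal{O}}$ into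 two remaining (open) hemisphere components $\mathbf{W}$ (West) and $\mathbf{E}$ (East). (iii) At end points on the meridians other than the poles $\mathbf{N},\mathbf{S}$, edges in $\mathbf{W}$ are directed towards the meridians and edges in $\mathbf{E}$ are directed away from the meridians. (iv) Let $\mathbf{NE}$ be the unique face in $\mathbf{W}$ containing the first edge of $\mathbf{WE}$ in its boundary, and $\mathbf{SW}$ the unique face in $\mathbf{E}$ containing the last edge of $\mathbf{WE}$ in its boundary. Then the boundaries of $\mathbf{NE}$ and $\mathbf{SW}$ share at least one edge of $\mathbf{WE}$. Similarly, let $\mathbf{NW}$ be the unique face in $\mathbf{W}$ adjacent to the first edge of $\mathbf{EW}$, and $\mathbf{SE}$ the unique face in $\mathbf{E}$ adjacent to the last edge of $\mathbf{EW}$. Then their boundaries share at least one edge of $\mathbf{EW}$. The data of a 3-cell template are the complex together with the bipolar orientation, the poles, the labeled meridians, and the labeled hemispheres; isomorphisms are cell-preserving homeomorphisms respecting all these data. Trivial equivalences: the Klein 4-group generated by two commuting involutions. $\kappa$ reverses all edge orientations and interchanges the labels $\mathbf{N}\leftrightarrow\mathbf{S}$, $\mathbf{WE}\leftrightarrow\mathbf{EW}$, $\mathbf{W}\leftrightarrow\mathbf{E}$. $\rho$ keeps all edge orientations, poles, and the labels of $\mathbf{W},\mathbf{E}$, and interchanges $\mathbf{WE}\leftrightarrow\mathbf{EW}$. The solid cube is the regular cell complex of a 3-cell whose boundary sphere complex is the boundary complex of the cube (8 vertices, 12 edges, 6 square faces). The pole distance $\delta$ is the edge distance of $\mathbf{N}$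 and $\mathbf{S}$ in the 1-skeleton $\mathcal{C}^1$. The number $\eta$ is the number of faces in the hemisphere ($\mathbf{W}$ or $\mathbf{E}$) with fewer faces; by the trivial equivalence $\kappa$ this may be taken to be $\mathbf{W}$. Background: by earlier work of the same authors, 3-cell templates are exactly the Thom-Smale complexes (decompositions into unstable manifolds of equilibria, with signed hemisphere decomposition) of Sturm 3-ball global attractors of dissipative PDEs $u_t=u_{xx}+f(x,u,u_x)$ on $0<x<1$ with Neumann boundary conditions and hyperbolic equilibria, and the template determines the Sturm permutation uniquely. *)

(* Defs.v *)
From HB Require Import structures.
From mathcomp Require Import all_boot all_order all_algebra.
From mathcomp Require Import all_classical all_reals all_analysis.

Set Implicit Arguments.
Unset Strict Implicit.
Unset Printing Implicit Defensive.

Import Order.TTheory GRing.Theory Num.Theory.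
Import numFieldNormedType.Exports.

Local Open Scope classical_set_scope.
Local Open Scope ring_scope.

(* [f] restricts to a homeomorphism from the subspace [A] of [X] onto the
   subspace [B] of [Y]; values of [f] outside [A] are irrelevant. *)
Definition homeo_on (X Y : topologicalType) (A : set X) (B : set Y)
    (f : X -> Y) : Prop :=
  exists g : Y -> X,
    [/\ forall x, A x -> B (f x) /\ g (f x) = x,
        forall y, B y -> A (g y) /\ f (g y) = y,
        {within A, continuous f} & {within B, continuous g}].

Definition unit_oball (R : realType) (n : nat) : set 'rV[R]_n :=
  [set x | \sum_(i < n) x 0 i ^+ 2 < 1].

Definition unit_cball (R : realType) (n : nat) : set 'rV[R]_n :=
  [set x | \sum_(i < n) x 0 i ^+ 2 <= 1].

(* A complex is realized inside an ambient space [space]; its underlying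
   space is the union [total] of its cells. *)
Record cell_complex := CellComplex {
  space : topologicalType;
  cell : finType;
  dim : cell -> nat;
  carrier : cell -> set space
}.
Arguments dim : clear implicits.
Arguments carrier : clear implicits.

Definition total (C : cell_complex) : set (space C) :=
  \bigcup_(c in [set: cell C]) carrier C c.

Definition skeleton_below (C : cell_complex) (n : nat) : set (space C) :=
  \bigcup_(c in [set c : cell C | (dim C c < n)%N]) carrier C c.

(* The boundary of a cell is taken relative to the cell itself: it is not the
   topological frontier in the ambient space. *)
Definition bd (C : cell_complex) (c : cell C) : set (space C) :=
  closure (carrier C c) `\` carrier C c.

Definition subcomplex (C : cell_complex) (A : set (space C)) : Prop :=
  closed A /\ exists P : set (cell C), A = \bigcup_(c in P) carrier C c.

Definition regular_CW (R : realType) (C : cell_complex) : Prop :=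
  [/\ hausdorff_space (space C),
      trivIset [set: cell C] (carrier C),
      forall c : cell C, exists chi : 'rV[R]_(dim C c) -> space C,
        homeo_on (@unit_cball R (dim C c)) (closure (carrier C c)) chi /\
        chi @` (@unit_oball R (dim C c)) = carrier C c &
      forall c : cell C,
        subcomplex (bd c) /\ bd c `<=` @skeleton_below C (dim C c)].

Definition complex_iso (C D : cell_complex)
    (h : space C -> space D) (phi : cell C -> cell D) : Prop :=
  [/\ homeo_on (@total C) (@total D) h,
      bijective phi,
      forall c, dim D (phi c) = dim C c &
      forall c, h @` carrier C c = carrier D (phi c)].

(* The open cells of [-1, 1]^3: coordinate [i] of a point of cell [s] is free
   in ]-1, 1[ if [s i = None], and fixed to 1 or -1 if [s i = Some b]. *)
Definition solid_cube (R : realType) : cell_complex :=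
  @CellComplex 'rV[R]_3 {ffun 'I_3 -> option bool}
    (fun s => #|[pred i | s i == None]|)
    (fun s => [set x | forall i : 'I_3,
       match s i with
       | None => -1 < x 0 i < 1
       | Some b => x 0 i = if b then 1 else -1
       end]).

Definition is_solid_cube (R : realType) (C : cell_complex) : Prop :=
  exists h phi, @complex_iso C (solid_cube R) h phi.

(* The orientation of an edge is given by its end points [etail] and [ehead];
   their values on cells of dimension other than 1 carry no information.
   Meridians are lists of edges, from the North to the South pole. *)
Record template_data := TemplateData {
  cplx :> cell_complex;
  etail : cell cplx -> cell cplx;
  ehead : cell cplx -> cell cplx;
  north : cell cplx;
  south : cell cplx;
  merWE : seq (cell cplx);
  merEW : seq (cell cplx);
  hemiW : set (space cplx);
  hemiE : set (space cplx)
}.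
Arguments etail : clear implicits.
Arguments ehead : clear implicits.
Arguments hemiW : clear implicits.
Arguments hemiE : clear implicits.

Definition arc (T : template_data) : rel (cell T) := fun u v =>
  [exists e : cell T, [&& dim T e == 1%N, etail T e == u & ehead T e == v]].

Definition oriented (T : template_data) : Prop :=
  forall e : cell T, dim T e = 1%N ->
    [/\ dim T (etail T e) = 0%N, dim T (ehead T e) = 0%N,
        etail T e <> ehead T e &
        bd e = carrier T (etail T e) `|` carrier T (ehead T e)].

Definition is_source (T : template_data) (v : cell T) : Prop :=
  dim T v = 0%N /\ forall u, ~~ arc u v.

Definition is_sink (T : template_data) (v : cell T) : Prop :=
  dim T v = 0%N /\ forall w, ~~ arc v w.

Definition bipolar (T : template_data) : Prop :=
  [/\ oriented T,
      forall s : seq (cell T), cycle (@arc T) s -> s = [::],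
      forall v : cell T, is_source v <-> v = north T &
      forall v : cell T, is_sink v <-> v = south T].

Fixpoint dipath (T : template_data) (u : cell T) (p : seq (cell T))
    (v : cell T) : bool :=
  if p is e :: q then
    [&& dim T e == 1%N, etail T e == u & dipath (ehead T e) q v]
  else u == v.

Definition support (T : template_data) (p : seq (cell T)) : set (space T) :=
  \bigcup_(e in [set` p]) closure (carrier T e).

Definition components (X : topologicalType) (A : set X) : set (set X) :=
  [set connected_component A x | x in A].

Definition meridian_vertex (T : template_data) (v : cell T) : Prop :=
  [/\ dim T v = 0%N, v <> north T, v <> south T &
      carrier T v `<=` support (merWE T) `|` support (merEW T)].

(* [f] is a face in the hemisphere [H] with the edge [e] in its boundary. *)
Definition face_at (T : template_data) (H : set (space T)) (e f : cell T)
    : Prop :=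
  [/\ dim T f = 2%N, carrier T f `<=` H & carrier T e `<=` bd f].

(* For the meridian [p = WE], [f] is the face NE and [g] is the face SW; for
   [p = EW], [f] is NW and [g] is SE. *)
Definition overlap (T : template_data) (p : seq (cell T)) : Prop :=
  exists e0 e1 f g : cell T,
    [/\ ohead p = Some e0, ohead (rev p) = Some e1,
        unique (face_at (hemiW T) e0) f, unique (face_at (hemiE T) e1) g &
        exists2 e, e \in p & carrier T e `<=` bd f `&` bd g].

Definition is_3cell_template (R : realType) (T : template_data) : Prop :=
  regular_CW R T /\
  exists O : cell T,
  [/\ dim T O = 3%N /\ closure (carrier T O) = @total T,
      [/\ bipolar T,
          dipath (north T) (merWE T) (south T),
          dipath (north T) (merEW T) (south T) &
          support (merWE T) `&` support (merEW T) =
            carrier T (north T) `|` carrier T (south T)],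
      hemiW T <> hemiE T /\
        components (bd O `\` (support (merWE T) `|` support (merEW T))) =
          [set hemiW T; hemiE T],
      forall e v : cell T, dim T e = 1%N -> meridian_vertex v ->
        carrier T v `<=` bd e ->
        (carrier T e `<=` hemiW T -> ehead T e = v) /\
        (carrier T e `<=` hemiE T -> etail T e = v) &
      overlap (merWE T) /\ overlap (merEW T)].

Definition template_iso (T U : template_data) : Prop :=
  exists (h : space T -> space U) (phi : cell T -> cell U),
  [/\ complex_iso h phi,
      forall e, dim T e = 1%N ->
        etail U (phi e) = phi (etail T e) /\ ehead U (phi e) = phi (ehead T e),
      phi (north T) = north U /\ phi (south T) = south U,
      map phi (merWE T) = merWE U /\ map phi (merEW T) = merEW U &
      h @` hemiW T = hemiW U /\ h @` hemiE T = hemiE U].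

Definition kappa (T : template_data) : template_data :=
  @TemplateData T (ehead T) (etail T) (south T) (north T)
    (rev (merEW T)) (rev (merWE T)) (hemiE T) (hemiW T).

Definition rho (T : template_data) : template_data :=
  @TemplateData T (etail T) (ehead T) (north T) (south T)
    (merEW T) (merWE T) (hemiW T) (hemiE T).

Definition equivalent (T U : template_data) : Prop :=
  [\/ template_iso T U, template_iso (kappa T) U,
      template_iso (rho T) U | template_iso (kappa (rho T)) U].

Definition edge_walk (T : template_data) (u v : cell T) (n : nat) : Prop :=
  exists p : seq (cell T),
    [/\ path (fun x y => arc x y || arc y x) u p, last u p = v & size p = n].

Definition pole_distance (T : template_data) (n : nat) : Prop :=
  edge_walk (north T) (south T) n /\
  forall m, edge_walk (north T) (south T) m -> (n <= m)%N.

Definition face_count (T : template_data) (H : set (space T)) : nat :=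
  #|[pred f : cell T | (dim T f == 2%N) && `[< carrier T f `<=` H >]]|.

Definition eta (T : template_data) : nat :=
  minn (face_count (hemiW T)) (face_count (hemiE T)).

(* Main.v *)
From mathcomp Require Import all_boot all_order all_algebra.
From mathcomp Require Import all_classical all_reals all_analysis.
From mathcomp Require Import ring lra zify.
Require Import Defs.

(* Through its face poset, a template on the cube amounts to a finite code: an
   orientation of the 12 edges, two poles, two directed paths, and two sets of cells.
   Open cells are connected, so each one lies in a single component of the complement
   of the meridians, and incident cells in the same component; conversely a set of
   cells of that complement is a component as soon as it and its complement are
   connected under incidence and unrelated to each other.  All conditions on a
   template thus become decidable conditions on its code.  Homeomorphisms between
   templates induce automorphisms of the face poset, which are the 48 signed
   permutations of the coordinates, and these are in turn induced by linear maps.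
   After moving the North pole to a fixed vertex, an enumeration of all orientations,
   meridians and colourings of the faces leaves only codes equivalent to one of
   seven, and these seven are pairwise inequivalent. *)

(** The two finite computations test different conditions. The enumeration uses cheap consequences
    of the template axioms: no directed cycle around a face, equal colours of the faces at an edge
    off the meridians, and so on. The seven codes are checked against a list of sufficient
    conditions, which includes acyclicity and connectedness of both hemispheres. Since every
    survivor of the enumeration is equivalent to one of the seven, the consequences suffice after
    the fact. The normal position of the North pole fixes the orientation of its three edges, which
    leaves $2^9$ orientations, to be combined with $2^6$ colourings of the faces. On the topological
    side, an isomorphism is a homeomorphism only between the unions of all cells, while incidence is
    read off closures in the ambient spaces. The two fit together because these unions are closed:
    the whole complex of a template is the closure of its 3-cell. *)

Set Implicit Arguments.
Unset Strict Implicit.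
Unset Printing Implicit Defensive.

Import Order.TTheory GRing.Theory Num.Theory.
Import numFieldNormedType.Exports.

Local Open Scope classical_set_scope.

(** * Cells of the cube *)

(* The cell [(a, b, c)] has its [i]-th coordinate fixed to 1 or -1 if the [i]-th
   component is [Some true] or [Some false], and free if it is [None]. *)
Definition cubecell := (option bool * option bool * option bool)%type.

(** The order is incidence: a cell lies below those whose closure contains it, as [cube_cubical]
    confirms. *)
Definition le_coord (a b : option bool) : bool :=
  match b, a with
  | None, _ => true
  | Some y, Some x => if y then x else ~~ x
  | Some _, None => false
  end.

Definition le_cell (c d : cubecell) : bool :=
  if le_coord c.1.1 d.1.1 then
    if le_coord c.1.2 d.1.2 then le_coord c.2 d.2 else false
  else false.

Definition eq_cell (c d : cubecell) : bool := if le_cell c d then le_cell d c else false.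
Lemma eq_cellP (c d : cubecell) : reflect (c = d) (eq_cell c d).
Proof.
by apply: (iffP idP) => [|->];
   [move: c d => [[[[]|] [[]|]] [[]|]] [[[[]|] [[]|]] [[]|]]
   |move: d => [[[[]|] [[]|]] [[]|]]].
Qed.

(* [vm_compute] evaluates both arguments of [&&] and [||], so the functions that
   occur in the enumeration below short-circuit by means of conditionals. *)
Section Short.
Variable T : Type.
Fixpoint allb (a : T -> bool) (s : seq T) : bool :=
  if s is x :: s' then if a x then allb a s' else false else true.
Fixpoint hasb (a : T -> bool) (s : seq T) : bool :=
  if s is x :: s' then if a x then true else hasb a s' else false.
Lemma allbE a s : allb a s = all a s.
Proof. by elim: s => //= x s ->. Qed.
Lemma hasbE a s : hasb a s = has a s.
Proof. by elim: s => //= x s ->. Qed.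
End Short.

Definition dim_coord (a : option bool) : nat := if a is None then 1 else 0.
Definition dim_cell (c : cubecell) : nat :=
  dim_coord c.1.1 + dim_coord c.1.2 + dim_coord c.2.

Definition cells : seq cubecell := Eval compute in
  let s := [:: Some false; Some true; None] in
  [seq (ab, c) | ab <- [seq (a, b) | a <- s, b <- s], c <- s].
Definition vertices : seq cubecell := Eval compute in [seq c <- cells | dim_cell c == 0].
Definition edges : seq cubecell := Eval compute in [seq c <- cells | dim_cell c == 1].
Definition faces : seq cubecell := Eval compute in [seq c <- cells | dim_cell c == 2].

Definition lo_end (e : cubecell) : cubecell :=
  let f a := if a is Some b then Some b else Some false in
  (f e.1.1, f e.1.2, f e.2).
Definition hi_end (e : cubecell) : cubecell :=
  let f a := if a is Some b then Some b else Some true in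
  (f e.1.1, f e.1.2, f e.2).

(** * Codes of templates *)

(* [ctail] and [chead] are only meaningful on edges; [cW] and [cE] are the sets of
   open cells that make up the hemispheres. *)
Record code := Code {
  ctail : cubecell -> cubecell; chead : cubecell -> cubecell;
  cnorth : cubecell; csouth : cubecell;
  cWE : seq cubecell; cEW : seq cubecell;
  cW : cubecell -> bool; cE : cubecell -> bool }.

Fixpoint lookup (es : seq cubecell) (bs : seq bool) (e : cubecell) : bool :=
  match es, bs with
  | x :: es', b :: bs' => if eq_cell x e then b else lookup es' bs' e
  | _, _ => true
  end.

Definition in_support (p : seq cubecell) (c : cubecell) : bool := hasb (le_cell c) p.

(** A cell off the meridians takes the colour of a face above it; [color_ok] makes all these faces
    agree. The 3-cell lies below no face and so belongs to neither hemisphere. *)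
Definition hemi (p q : seq cubecell) (w : cubecell -> bool) (c : cubecell) : bool :=
  if in_support p c then false else if in_support q c then false else
  hasb (fun f => if le_cell c f then w f else false) faces.

(** The normal position of the North pole, reached by a symmetry in [vertex_to_corner]. *)
Definition corner : cubecell := (Some false, Some false, Some false).

Definition tail_of (o : seq bool) e := if lookup edges o e then lo_end e else hi_end e.
Definition head_of (o : seq bool) e := if lookup edges o e then hi_end e else lo_end e.

(* The bits [o] orient the edges, [true] meaning by increasing coordinate; the
   bits [w] tell which faces lie in the Western hemisphere. *)
Definition mk_code (o : seq bool) (S : cubecell) (p q : seq cubecell)
    (w : seq bool) : code :=
  Code (tail_of o) (head_of o) corner S p q
    (hemi p q (lookup faces w)) (hemi p q (fun f => ~~ lookup faces w f)).

Definition kappa_code (d : code) : code :=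
  Code (chead d) (ctail d) (csouth d) (cnorth d)
       (rev (cEW d)) (rev (cWE d)) (cE d) (cW d).
Definition rho_code (d : code) : code :=
  Code (ctail d) (chead d) (cnorth d) (csouth d)
       (cEW d) (cWE d) (cW d) (cE d).

Definition crd (c : cubecell) (i : nat) : option bool :=
  match i with 0 => c.1.1 | 1 => c.1.2 | _ => c.2 end.
Definition ofcrd (f : nat -> option bool) : cubecell := (f 0, f 1, f 2).

(* The symmetry [(p, b)] takes the [i]-th coordinate of the image of a cell to be the
   [nth 0 p i]-th coordinate of that cell, negated if [nth false b i]. *)
Definition symm := (seq nat * seq bool)%type.
Definition sperm (g : symm) : seq nat := g.1.
Definition sflip (g : symm) : seq bool := g.2.
Definition act_cell (g : symm) (c : cubecell) : cubecell :=
  ofcrd (fun i => let a := crd c (nth 0 (sperm g) i) in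
                  if nth false (sflip g) i then omap negb a else a).
(** Coordinate [i] of the original cell sits at the position where [sperm g] has the entry [i], and
    the sign to undo is the one applied at that position. *)
Definition symm_inv (g : symm) : symm :=
  let p := [seq index i (sperm g) | i <- iota 0 3] in
  (p, [seq nth false (sflip g) i | i <- p]).

Fixpoint bitseqs (n : nat) : seq (seq bool) :=
  if n is n'.+1 then
    let s := bitseqs n' in [seq true :: t | t <- s] ++ [seq false :: t | t <- s]
  else [:: [::]].

Definition symms : seq symm := Eval compute in
  [seq (p, b) | p <- [:: [:: 0; 1; 2]; [:: 0; 2; 1]; [:: 1; 0; 2];
                          [:: 1; 2; 0]; [:: 2; 0; 1]; [:: 2; 1; 0]],
                  b <- bitseqs 3].

Definition act_code (g : symm) (d : code) : code :=
  let h := symm_inv g in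
  Code (fun e => act_cell g (ctail d (act_cell h e)))
       (fun e => act_cell g (chead d (act_cell h e)))
       (act_cell g (cnorth d)) (act_cell g (csouth d))
       (map (act_cell g) (cWE d)) (map (act_cell g) (cEW d))
       (fun c => cW d (act_cell h c)) (fun c => cE d (act_cell h c)).

Fixpoint eq_cells (p q : seq cubecell) : bool :=
  match p, q with
  | [::], [::] => true
  | x :: p', y :: q' => if eq_cell x y then eq_cells p' q' else false
  | _, _ => false
  end.

(** End points are compared on edges only, where they carry information. The comparisons of poles
    and paths come first, so that most symmetries are rejected before any function is evaluated on
    all cells. *)
Definition eq_code (d d' : code) : bool :=
  if eq_cell (csouth d) (csouth d') then
  if eq_cells (cWE d) (cWE d') then
  if eq_cells (cEW d) (cEW d') then
  if eq_cell (cnorth d) (cnorth d') then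
  if allb (fun e => if eq_cell (ctail d e) (ctail d' e)
                    then eq_cell (chead d e) (chead d' e) else false) edges then
  if allb (fun c => eqb (cW d c) (cW d' c)) cells then
  allb (fun c => eqb (cE d c) (cE d' c)) cells
  else false else false else false else false else false else false.

Definition kleins (d : code) : seq code :=
  [:: d; kappa_code d; rho_code d; kappa_code (rho_code d)].

Definition equiv_code (d d' : code) : bool :=
  hasb (fun k => hasb (fun g => eq_code (act_code g k) d') symms) (kleins d).

(* Acyclicity enters the enumeration only through the boundaries of the faces: this
   already excludes enough orientations. *)
Definition face_cycles : seq (seq cubecell) :=
  let sq (h : bool -> bool -> cubecell) :=
    let s := [:: h false false; h false true; h true true; h true false] in
    [:: s; rev s] in
  flatten [seq sq (fun x y => (Some b, Some x, Some y)) ++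
               sq (fun x y => (Some x, Some b, Some y)) ++
               sq (fun x y => (Some x, Some y, Some b)) | b <- [:: false; true]].

Definition in_arc (o : seq bool) (u v : cubecell) : bool :=
  hasb (fun e => if eq_cell (tail_of o e) u then eq_cell (head_of o e) v else false) edges.

Definition source_only (o : seq bool) : bool :=
  allb (fun v => if eq_cell v corner then true else
    hasb (fun e => eq_cell (head_of o e) v) edges) vertices.

Definition sink_only (o : seq bool) (S : cubecell) : bool :=
  if hasb (fun e => eq_cell (tail_of o e) S) edges then false else
  allb (fun v => if eq_cell v S then true else
    hasb (fun e => eq_cell (tail_of o e) v) edges) vertices.

Definition is_dicycle (r : cubecell -> cubecell -> bool) (s : seq cubecell) : bool :=
  if s is x :: p then
    (fix walk y q := if q is z :: q' then if r y z then walk z q' else false else r y x) x p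
  else false.

Definition orient_ok (o : seq bool) : bool :=
  if source_only o then
    if hasb (is_dicycle (in_arc o)) face_cycles then false else true
  else false.

Fixpoint paths (t h : cubecell -> cubecell) (n : nat) (u v : cubecell) :
    seq (seq cubecell) :=
  if eq_cell u v then [:: [::]] else
  if n is n'.+1 then
    flatten [seq [seq e :: p | p <- paths t h n' (h e) v] | e <- edges & eq_cell (t e) u]
  else [::].

Definition meet_ok (S : cubecell) (p q : seq cubecell) : bool :=
  allb (fun c => if in_support p c then
                   if in_support q c then if eq_cell c corner then true else eq_cell c S else true
                 else true) cells.

(** Both colours occur because components are nonempty; faces that meet in an edge off the meridians
    lie in the same component. *)
Definition color_ok (p q : seq cubecell) (w : cubecell -> bool) : bool :=
  if hasb w faces then if hasb (fun f => ~~ w f) faces then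
   allb (fun e => if in_support p e then true else if in_support q e then true else
     let s := [seq f <- faces | le_cell e f] in
      allb (fun f => allb (fun f' => eqb (w f) (w f')) s) s) edges
  else false else false.

Definition local_ok (d : code) : bool :=
  allb (fun v => if eq_cell v (cnorth d) then true else if eq_cell v (csouth d) then true
    else if (if in_support (cWE d) v then true else in_support (cEW d) v) then
     allb (fun e => if le_cell v e then
       if cW d e then eq_cell (chead d e) v else
       if cE d e then eq_cell (ctail d e) v else true else true) edges else true) vertices.

Definition overlap_ok (d : code) (p : seq cubecell) : bool :=
  if p is e0 :: _ then
    let e1 := last e0 p in
    hasb (fun f => if cW d f then if le_cell e0 f then
      hasb (fun g => if cE d g then if le_cell e1 g then
         hasb (fun e => if le_cell e f then le_cell e g else false) p
         else false else false) faces else false else false) faces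
  else false.

Definition code_ok (d : code) : bool :=
  if local_ok d then if overlap_ok d (cWE d) then overlap_ok d (cEW d)
  else false else false.

(** An edge at [corner] has to leave it, and [corner] is its lower end, so its bit is [true]. The
    other nine bits are free. *)
Definition orients : seq (seq bool) :=
  foldr (fun e s => if le_cell corner e then [seq true :: t | t <- s]
                    else [seq true :: t | t <- s] ++ [seq false :: t | t <- s])
        [:: [::]] edges.

(* Obtained by an exhaustive search outside Rocq, and listed in the order of the
   values of the pole distance and of [eta] in the theorem. *)
Definition reps : seq code := [::
  mk_code [:: true; true; true; true; false; true; false; false; true; true; true; true]
    (Some true, Some false, Some false)
    [:: (Some false, None, Some false); (None, Some true, Some false); (Some true, None, Some false)]
    [:: (None, Some false, Some false)]
    [:: false; false; false; false; true; false];
  mk_code [:: true; true; true; false; true; true; true; true; true; false; false; false]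
    (Some false, Some false, Some true)
    [:: (Some false, Some false, None)]
    [:: (Some false, None, Some false); (Some false, Some true, None); (Some false, None, Some true)]
    [:: false; true; true; true; true; true];
  mk_code [:: true; true; true; false; true; false; true; true; true; false; false; false]
    (Some false, Some false, Some true)
    [:: (Some false, Some false, None)]
    [:: (Some false, None, Some false); (Some false, Some true, None); (Some false, None, Some true)]
    [:: false; true; true; true; true; true];
  mk_code [:: true; true; true; true; true; true; true; true; true; true; true; false]
    (Some false, Some true, Some true)
    [:: (Some false, Some false, None); (Some false, None, Some true)]
    [:: (Some false, None, Some false); (Some false, Some true, None)]
    [:: true; false; false; false; false; false];
  mk_code [:: true; true; true; true; true; true; true; false; true; true; false; true]
    (Some true, Some false, Some true)
    [:: (Some false, Some false, None); (None, Some false, Some true)]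
    [:: (None, Some false, Some false); (Some true, Some false, None)]
    [:: false; false; true; false; false; false];
  mk_code [:: true; true; true; true; true; true; true; true; true; true; false; false]
    (Some false, Some true, Some true)
    [:: (Some false, Some false, None); (Some false, None, Some true)]
    [:: (None, Some false, Some false); (Some true, None, Some false); (None, Some true, Some false);
        (Some false, Some true, None)]
    [:: true; false; false; false; true; false];
  mk_code [:: true; true; true; true; true; true; true; true; true; true; true; true]
    (Some true, Some true, Some true)
    [:: (Some false, Some false, None); (Some false, None, Some true); (None, Some true, Some true)]
    [:: (None, Some false, Some false); (Some true, None, Some false); (Some true, Some true, None)]
    [:: true; false; false; true; true; false]].

(* A directed path visits each of the 8 vertices at most once, whence the bound 7. *)
Definition classified : bool :=
  allb (fun o => if orient_ok o then allb (fun S => if sink_only o S then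
    let P := paths (tail_of o) (head_of o) 7 corner S in
     allb (fun p => allb (fun q => if meet_ok S p q then
       allb (fun w => if color_ok p q (lookup faces w) then
         let d := mk_code o S p q w in if code_ok d then hasb (equiv_code d) reps else true
         else true)
       (bitseqs 6) else true) P) P else true) vertices else true) orients.

Lemma mem_cells c : c \in cells.
Proof. by case: c => [[[[]|] [[]|]] [[]|]]. Qed.
Lemma mem_vertices c : (c \in vertices) = (dim_cell c == 0).
Proof. by case: c => [[[[]|] [[]|]] [[]|]]. Qed.
Lemma mem_edges c : (c \in edges) = (dim_cell c == 1).
Proof. by case: c => [[[[]|] [[]|]] [[]|]]. Qed.
Lemma mem_faces c : (c \in faces) = (dim_cell c == 2).
Proof. by case: c => [[[[]|] [[]|]] [[]|]]. Qed.

(** * Sufficient conditions for a code to be that of a template *)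

Fixpoint cell_dipath (t h : cubecell -> cubecell) (u : cubecell)
    (p : seq cubecell) (v : cubecell) : bool :=
  if p is e :: q then [&& dim_cell e == 1, t e == u & cell_dipath t h (h e) q v]
  else u == v.

Definition hemi_cells (h : cubecell -> bool) : seq cubecell := [seq c <- cells | h c].

Fixpoint grow (A s : seq cubecell) : seq cubecell :=
  if A is c :: A' then
    if hasb (fun b => if le_cell b c then true else le_cell c b) s
    then grow A' (c :: s) else grow A' s
  else s.

(* Four rounds of [grow] suffice for all the hemispheres that occur. *)
Definition conn_cells (h : cubecell -> bool) : bool :=
  let A := hemi_cells h in
  if A is c :: _ then
    let s := iter 4 (grow A) [:: c] in all (mem s) A && all h s
  else false.

(* The length of a longest directed path from the North pole: since it increases along
   all edges, there is no directed cycle. *)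
Definition code_rank (d : code) (v : cubecell) : nat :=
  foldr maxn 0 (map size (paths (ctail d) (chead d) 7 (cnorth d) v)).

Definition code_oriented (d : code) : bool :=
  all (fun e => [&& dim_cell (ctail d e) == 0, dim_cell (chead d e) == 0,
    code_rank d (ctail d e) < code_rank d (chead d e) &
    all (fun c => (le_cell c e && (c != e)) == ((c == ctail d e) || (c == chead d e)))
      cells]) edges.

Definition code_poles (d : code) : bool :=
  [&& dim_cell (cnorth d) == 0, dim_cell (csouth d) == 0 &
  all (fun v => (all (fun e => chead d e != v) edges == (v == cnorth d)) &&
                (all (fun e => ctail d e != v) edges == (v == csouth d))) vertices].

Definition code_meridians (d : code) : bool :=
  [&& cell_dipath (ctail d) (chead d) (cnorth d) (cWE d) (csouth d),
      cell_dipath (ctail d) (chead d) (cnorth d) (cEW d) (csouth d) &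
      all (fun c => (in_support (cWE d) c && in_support (cEW d) c) ==
                    ((c == cnorth d) || (c == csouth d))) cells].

Definition code_hemis (d : code) : bool :=
  [&& conn_cells (cW d), conn_cells (cE d),
   all (fun c => ((dim_cell c < 3) && ~~ (in_support (cWE d) c || in_support (cEW d) c))
                 == (cW d c || cE d c)) cells &
   all (fun b => all (fun c =>
     le_cell b c || le_cell c b ==> ~~ (cW d b && cE d c)) cells) cells].

(** Existence of the faces at the two ends of a meridian comes from [overlap_ok], which also rejects
    the empty path, so the default [corner] is never met. *)
Definition code_unique (d : code) (p : seq cubecell) : bool :=
  let u (h : cubecell -> bool) (e : cubecell) :=
    all (fun f => all (fun f' => [&& h f, le_cell e f, h f' & le_cell e f'] ==> (f == f'))
     faces) faces in
  u (cW d) (head corner p) && u (cE d) (last corner p).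

Definition good_code (d : code) : bool :=
  [&& code_oriented d, code_poles d, code_meridians d, code_hemis d, local_ok d,
      overlap_ok d (cWE d), overlap_ok d (cEW d), code_unique d (cWE d) &
      code_unique d (cEW d)].

Lemma reps_good : all good_code reps.
Proof. by vm_compute. Qed.

Lemma overlap_okP d e0 p :
  reflect (exists f g e, [/\ f \in faces, g \in faces, e \in e0 :: p,
      [/\ cW d f, le_cell e0 f & le_cell e f] &
      [/\ cE d g, le_cell (last e0 p) g & le_cell e g]])
    (overlap_ok d (e0 :: p)).
Proof.
rewrite /overlap_ok hasbE; apply: (iffP hasP) => [[f ff]|].
  case: ifP => // Wf; case: ifP => // lf; rewrite hasbE => /hasP[g gg].
  case: ifP => // Eg; case: ifP => // lg; rewrite hasbE => /hasP[e ep].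
  by case: ifP => // h1 h2; exists f, g, e.
move=> [f [g [e [ff gg ep [Wf lf h1] [Eg lg h2]]]]]; exists f => //.
rewrite Wf lf hasbE; apply/hasP; exists g => //.
rewrite Eg lg hasbE; apply/hasP; exists e => //.
by rewrite h1 h2.
Qed.

(** * Symmetries of the cube and automorphisms of its face poset *)

Definition antipode (c : cubecell) : cubecell :=
  (omap negb c.1.1, omap negb c.1.2, omap negb c.2).

Definition symm_act_ok (g : symm) : bool :=
  all (fun c => [&& eq_cell (act_cell (symm_inv g) (act_cell g c)) c,
                    eq_cell (act_cell g (act_cell (symm_inv g) c)) c,
                    dim_cell (act_cell g c) == dim_cell c,
                    eq_cell (act_cell g (antipode c)) (antipode (act_cell g c)) &
                    all (fun f => le_cell (act_cell g c) (act_cell g f) == le_cell c f) faces]) cells.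

Definition symm_crd_ok (g : symm) : bool :=
  all (fun i => [&& nth 0 (sperm g) i < 3, nth 0 (sperm (symm_inv g)) i < 3,
       nth 0 (sperm g) (nth 0 (sperm (symm_inv g)) i) == i,
       nth 0 (sperm (symm_inv g)) (nth 0 (sperm g) i) == i,
       nth false (sflip (symm_inv g)) i ==
         nth false (sflip g) (nth 0 (sperm (symm_inv g)) i) &
       nth false (sflip (symm_inv g)) (nth 0 (sperm g) i) == nth false (sflip g) i])
    (iota 0 3).

Lemma symms_act_ok : all symm_act_ok symms.
Proof. by vm_compute. Qed.

Lemma symms_crd_ok : all symm_crd_ok symms.
Proof. by vm_compute. Qed.

Section Symm.
Variable g : symm.
Hypothesis gs : g \in symms.

Let factP c : [/\ act_cell (symm_inv g) (act_cell g c) = c,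
   act_cell g (act_cell (symm_inv g) c) = c,
   dim_cell (act_cell g c) = dim_cell c, act_cell g (antipode c) = antipode (act_cell g c) &
   forall f, f \in faces -> le_cell (act_cell g c) (act_cell g f) = le_cell c f].
Proof.
have /allP/(_ _ (mem_cells c)) := allP symms_act_ok _ gs.
move=> /and5P[/eq_cellP ? /eq_cellP ? /eqP ? /eq_cellP ? /allP h]; split=> // f ff.
exact/eqP/h.
Qed.

Lemma act_cellK : cancel (act_cell g) (act_cell (symm_inv g)).
Proof. by move=> c; have [] := factP c. Qed.

Lemma act_cellKV : cancel (act_cell (symm_inv g)) (act_cell g).
Proof. by move=> c; have [] := factP c. Qed.

Lemma dim_act_cell c : dim_cell (act_cell g c) = dim_cell c.
Proof. by have [] := factP c. Qed.

Lemma antipode_act c : act_cell g (antipode c) = antipode (act_cell g c).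
Proof. by have [] := factP c. Qed.

Lemma le_act_cell_face c f : f \in faces ->
  le_cell (act_cell g c) (act_cell g f) = le_cell c f.
Proof. by have [_ _ _ _] := factP c; apply. Qed.

End Symm.

(** Each fixed coordinate of a cell names one face above it, and there are no other faces above
    it. *)
Lemma cell_ext c d : (forall f, f \in faces -> le_cell c f = le_cell d f) -> c = d.
Proof.
have : all (fun c => all (fun d =>
    all (fun f => le_cell c f == le_cell d f) faces ==> eq_cell c d) cells) cells.
  by vm_compute.
move=> /allP/(_ _ (mem_cells c))/allP/(_ _ (mem_cells d))/implyP h e.
by apply/eq_cellP/h/allP => f ff; rewrite e.
Qed.

Lemma faces_meet f f' : f \in faces -> f' \in faces ->
  has (fun c => le_cell c f && le_cell c f') cells = (f' != antipode f).
Proof.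
have : all (fun f => all (fun f' =>
   has (fun c => le_cell c f && le_cell c f') cells == (f' != antipode f)) faces) faces.
  by vm_compute.
by move=> /allP h /h /allP h' /h' /eqP.
Qed.

Lemma antipode_face f : (antipode f \in faces) = (f \in faces).
Proof. by rewrite !mem_faces; case: f => [[[[]|] [[]|]] [[]|]]. Qed.

(* Opposite faces are those without a common cell, so an automorphism of the face
   poset is determined by the images of the three faces at a vertex. *)
Section Automorphism.
Variable s : cubecell -> cubecell.
Hypothesis s_bij : bijective s.
Hypothesis s_dim : forall c, dim_cell (s c) = dim_cell c.
Hypothesis s_le : forall c d, le_cell (s c) (s d) = le_cell c d.

Let s_face f : (s f \in faces) = (f \in faces).
Proof. by rewrite !mem_faces s_dim. Qed.

Let s_antipode f : f \in faces -> s (antipode f) = antipode (s f).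
Proof.
move=> ff; have off : antipode f \in faces by rewrite antipode_face.
apply/eqP; rewrite -[_ == _]negbK -faces_meet ?s_face //.
apply/hasPn => d _; have [s' sK s'K] := s_bij.
rewrite -(s'K d) !s_le.
have := faces_meet ff off; rewrite eqxx => /negbT/hasPn; apply; exact: mem_cells.
Qed.

Lemma automorphism_symm : exists2 g, g \in symms & forall c, s c = act_cell g c.
Proof.
pose F0 : cubecell := (Some false, None, None).
pose F1 : cubecell := (None, Some false, None).
pose F2 : cubecell := (None, None, Some false).
have s_inj := bij_inj s_bij.
have ne f f' : f \in faces -> f' \in faces -> f != f' -> f' != antipode f ->
    (s f != s f') && (s f' != antipode (s f)).
  by move=> ff ff' n1 n2; rewrite -s_antipode // !(inj_eq s_inj) n1.
(* Three faces, no two of them equal or opposite, belong to the three different axes. The axes give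
   the permutation and the sides give the signs. *)
have chk : all (fun a => all (fun b => all (fun c =>
    [&& a != b, b != antipode a, a != c, c != antipode a, b != c & c != antipode b] ==>
    has (fun g => [&& act_cell g F0 == a, act_cell g F1 == b & act_cell g F2 == c]) symms)
   faces) faces) faces by vm_compute.
have [g gs /and3P[/eqP g0 /eqP g1 /eqP g2]] :
    exists2 g, g \in symms &
      [&& act_cell g F0 == s F0, act_cell g F1 == s F1 & act_cell g F2 == s F2].
  apply/hasP.
  have f0 : s F0 \in faces by rewrite s_face.
  have f1 : s F1 \in faces by rewrite s_face.
  have f2 : s F2 \in faces by rewrite s_face.
  have /allP/(_ _ f1)/allP/(_ _ f2)/implyP := allP chk _ f0; apply.
  have /andP[-> ->] := ne F0 F1 isT isT isT isT.
  have /andP[-> ->] := ne F0 F2 isT isT isT isT.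
  by have /andP[-> ->] := ne F1 F2 isT isT isT isT.
exists g => //.
have on_face f : f \in faces -> s f = act_cell g f.
  move=> ff; have : f \in [:: F0; F1; F2; antipode F0; antipode F1; antipode F2].
    have : all (fun f => f \in
      [:: F0; F1; F2; antipode F0; antipode F1; antipode F2]) faces by vm_compute.
    by move=> /allP; apply.
  by rewrite !inE => /orP[/eqP->|/orP[/eqP->|/orP[/eqP->|/orP[/eqP->|/orP[]/eqP->]]]];
     rewrite ?s_antipode // ?(antipode_act gs) ?g0 ?g1 ?g2.
(* A cell is determined by the faces above it, so agreement on faces spreads to all cells once [f]
   is pulled back along [s]. *)
move=> c; apply: cell_ext => f ff; have [s' sK s'K] := s_bij.
have ff' : s' f \in faces by rewrite -s_face s'K.
by rewrite -{1}(s'K f) s_le -[in RHS](s'K f) on_face // (le_act_cell_face gs).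
Qed.
End Automorphism.

Lemma reps_distinct (i j : nat) (d0 : code) : i < 7 -> j < 7 ->
  equiv_code (nth d0 reps i) (nth d0 reps j) -> i = j.
Proof.
have chk : all (fun i => all (fun j =>
   if equiv_code (nth d0 reps i) (nth d0 reps j) then i == j else true)
   (iota 0 7)) (iota 0 7) by vm_compute.
move=> i7 j7; have mi : i \in iota 0 7 by rewrite mem_iota.
have mj : j \in iota 0 7 by rewrite mem_iota.
have /allP/(_ _ mj) := allP chk _ mi.
by move: (equiv_code _ _) => -[/eqP|].
Qed.

(** * Completeness of the enumeration *)

Lemma lookup_map (es : seq cubecell) (b : cubecell -> bool) e :
  e \in es -> lookup es (map b es) e = b e.
Proof.
elim: es => //= x es IH; rewrite inE => /orP[/eqP <-|ees].
  by case: eq_cellP.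
by case: eq_cellP => [->|_] //; exact: IH.
Qed.

Lemma mem_bitseqs n (s : seq bool) : size s = n -> s \in bitseqs n.
Proof.
elim: n s => [|n IH] [|b s] //= [/IH sb]; rewrite mem_cat.
by case: b; apply/orP; [left|right]; apply: map_f.
Qed.

Lemma mem_orients (b : cubecell -> bool) :
  (forall e, e \in edges -> le_cell corner e -> b e) -> map b edges \in orients.
Proof.
rewrite /orients; elim: edges => [|e es IH] hb; first by rewrite inE.
have {}IH := IH (fun e' es' => hb e' (mem_behead (s := e :: es) es')).
rewrite -[map b (e :: es)]/(b e :: map b es) [foldr _ _ (e :: es)]/=.
case: ifP => [le|_].
  by rewrite hb ?mem_head //; apply: map_f.
rewrite mem_cat; apply/orP.
by case: (b e); [left|right]; apply: map_f.
Qed.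

Lemma is_dicycleE (r : rel cubecell) s : s != [::] -> is_dicycle r s = cycle r s.
Proof.
case: s => [//|x p] _ /=.
elim: p {2 3}x => [|z p IH] y /=; first by rewrite andbT.
by rewrite IH; case: (r y z).
Qed.

Lemma face_cycles_neq0 s : s \in face_cycles -> s != [::].
Proof.
have : all (fun s => s != [::]) face_cycles by vm_compute.
by move=> /allP; apply.
Qed.

Lemma pathsE t h n u v : paths t h n u v =
  if eq_cell u v then [:: [::]] else
  if n is n'.+1 then
    flatten [seq [seq e :: p | p <- paths t h n' (h e) v] | e <- edges & eq_cell (t e) u]
  else [::].
Proof. by case: n. Qed.

(** [paths] stops as soon as it reaches [v], so it would miss a path that runs through [v] and
    returns. No edge leaves [v], which excludes this. *)
Lemma paths_complete (t h : cubecell -> cubecell) n u p v :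
  cell_dipath t h u p v -> size p <= n -> (forall e, e \in edges -> t e != v) ->
  p \in paths t h n u v.
Proof.
move=> + + sink; elim: n u p => [|n IH] u [|e p]; rewrite pathsE.
- by move=> /eqP -> _; case: eq_cellP; rewrite ?inE.
- by [].
- by move=> /eqP -> _; case: eq_cellP; rewrite ?inE.
move=> /and3P[de /eqP te dp] sz.
have ee : e \in edges by rewrite mem_edges.
case: eq_cellP => [uv|_].
  by have := sink _ ee; rewrite te uv eqxx.
apply/flattenP; exists [seq e :: p0 | p0 <- paths t h n (h e) v].
  by apply/mapP; exists e => //; rewrite mem_filter ee te andbT; apply/eq_cellP.
by apply: map_f; exact: IH.
Qed.

(** The whole case analysis is this one evaluation. Each choice is filtered before the next is made:
    orientation, South pole, pair of paths, colouring. *)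
Lemma classified_true : classified.
Proof. by vm_compute. Qed.

Lemma classifiedP (o : seq bool) (S : cubecell) (p q : seq cubecell) (w : seq bool) :
  o \in orients -> orient_ok o -> S \in vertices -> sink_only o S ->
  p \in paths (tail_of o) (head_of o) 7 corner S ->
  q \in paths (tail_of o) (head_of o) 7 corner S ->
  meet_ok S p q -> w \in bitseqs 6 -> color_ok p q (lookup faces w) ->
  code_ok (mk_code o S p q w) -> has (equiv_code (mk_code o S p q w)) reps.
Proof.
move=> oo ook vS sS pP qP mok wb cok dok.
have := classified_true; rewrite /classified allbE => /allP/(_ _ oo).
rewrite ook allbE => /allP/(_ _ vS).
rewrite sS allbE => /allP/(_ _ pP); rewrite allbE => /allP/(_ _ qP).
rewrite mok allbE => /allP/(_ _ wb).
by rewrite cok dok hasbE.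
Qed.

(** * Complexes with the face poset of the cube *)

(** The interface between topology and combinatorics: these properties hold for the cube and pass to
    every complex isomorphic to it by [iso_cubical], so the lemmas below serve for both. *)
Record cubical (C : cell_complex) (phi : cell C -> cubecell) : Prop := Cubical {
  cub_bij : bijective phi;
  cub_dim : forall c, dim C c = dim_cell (phi c);
  cub_disj : trivIset [set: cell C] (carrier C);
  cub_conn : forall c, connected (carrier C c);
  cub_ne : forall c, carrier C c !=set0;
  cub_cl : forall c, closure (carrier C c) =
    \bigcup_(b in [set b | le_cell (phi b) (phi c)]) carrier C b }.

Arguments cub_conn {C phi}.
Arguments cub_ne {C phi}.
Arguments cub_dim {C phi}.
Arguments cub_cl {C phi}.

Lemma le_cell_refl c : le_cell c c.
Proof. by case: c => [[[[]|] [[]|]] [[]|]]. Qed.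

Lemma le_cell_anti c d : le_cell c d -> le_cell d c -> c = d.
Proof. by move=> h1 h2; apply/eq_cellP; rewrite /eq_cell h1. Qed.

Lemma le_cellE c d :
  le_cell c d = [&& le_coord c.1.1 d.1.1, le_coord c.1.2 d.1.2 & le_coord c.2 d.2].
Proof. by []. Qed.

Lemma le_coord_trans x y z : le_coord x y -> le_coord y z -> le_coord x z.
Proof. by case: x y z => [[]|] [[]|] [[]|]. Qed.

Lemma le_cell_trans b c d : le_cell b c -> le_cell c d -> le_cell b d.
Proof.
rewrite !le_cellE => /and3P[h1 h2 h3] /and3P[g1 g2 g3].
by rewrite (le_coord_trans h1 g1) (le_coord_trans h2 g2) (le_coord_trans h3 g3).
Qed.

Section CubicalTheory.
Variables (C : cell_complex) (phi : cell C -> cubecell).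
Hypothesis H : cubical phi.

Let cup (P : set (cell C)) : set (space C) := \bigcup_(c in P) carrier C c.

Lemma cub_inj : injective phi.
Proof. exact: bij_inj (cub_bij H). Qed.

Lemma cub_surj k : exists c, phi c = k.
Proof. by have [g _ gK] := cub_bij H; exists (g k). Qed.

Lemma cub_meet b c x : carrier C b x -> carrier C c x -> b = c.
Proof. by move=> bx cx; apply: (cub_disj H) => //; exists x. Qed.

(** Cells are disjoint and nonempty, so a single point identifies its cell. Inclusions between
    unions of cells thus turn into statements about sets of labels. *)
Lemma sub_cup c (P : set (cell C)) : carrier C c `<=` cup P <-> P c.
Proof.
split=> [sub|Pc x cx]; last by exists c.
have [x cx] := cub_ne H c; have [b Pb bx] := sub _ cx.
by rewrite (cub_meet cx bx).
Qed.

Lemma cup_inj (P Q : set (cell C)) : cup P = cup Q -> P = Q.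
Proof.
move=> e; apply/seteqP; split=> c Pc; apply/sub_cup.
  by rewrite -e; apply/sub_cup.
by rewrite e; apply/sub_cup.
Qed.

Lemma carrier_cup c : carrier C c = cup [set c].
Proof. by rewrite /cup bigcup_set1. Qed.

Lemma cupD (P Q : set (cell C)) : cup P `\` cup Q = cup (P `\` Q).
Proof.
apply/seteqP; split=> x.
  move=> [[c Pc cx] nQ]; exists c => //; split=> // Qc; apply: nQ.
  by exists c.
move=> [c [Pc nQc] cx]; split; first by exists c.
by move=> [b Qb bx]; apply: nQc; rewrite (cub_meet cx bx).
Qed.

Lemma cupU (P Q : set (cell C)) : cup P `|` cup Q = cup (P `|` Q).
Proof. by rewrite /cup bigcup_setU. Qed.

Lemma cupI (P Q : set (cell C)) : cup P `&` cup Q = cup (P `&` Q).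
Proof.
apply/seteqP; split=> x.
  move=> [[c Pc cx] [b Qb bx]]; exists c => //; split=> //.
  by rewrite (cub_meet cx bx).
by move=> [c [Pc Qc] cx]; split; exists c.
Qed.

Lemma bdE c : bd c = cup [set b | le_cell (phi b) (phi c) /\ b <> c].
Proof. by rewrite /bd (cub_cl H) [X in _ `\` X]carrier_cup cupD. Qed.

Lemma sub_bd b c : carrier C b `<=` bd c <-> le_cell (phi b) (phi c) /\ b <> c.
Proof. by rewrite bdE sub_cup. Qed.

Lemma sub_closure b c : carrier C b `<=` closure (carrier C c) <->
  le_cell (phi b) (phi c).
Proof. by rewrite (cub_cl H) sub_cup. Qed.

Lemma closure_cup (P : set (cell C)) :
  closure (cup P) = cup [set b | exists2 c, P c & le_cell (phi b) (phi c)].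
Proof.
apply/seteqP; split=> x; last first.
  move=> [b [c Pc le] bx]; have /sub_closure/(_ x bx) := le.
  by apply: closureS => y cy; exists c.
have -> : cup [set b | exists2 c, P c & le_cell (phi b) (phi c)] =
    \bigcup_(c in P) closure (carrier C c).
  apply/seteqP; split=> y.
    by move=> [b [c Pc le] bx]; exists c => //; rewrite (cub_cl H); exists b.
  by move=> [c Pc]; rewrite (cub_cl H) => -[b le bx]; exists b => //; exists c.
(* There are finitely many cells, so this is a finite union of closed sets. *)
have cl : closed (\bigcup_(c in P) closure (carrier C c)).
  by apply: closed_bigcup => [|c _]; [exact: finite_finset|exact: closed_closure].
move/closure_id: cl => ->; apply: closureS => y [c Pc cy]; exists c => //.
exact: subset_closure.
Qed.

End CubicalTheory.

Arguments cub_inj {C phi}.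

Lemma supportE (T : template_data) (phi : cell T -> cubecell) (p : seq (cell T)) :
  cubical phi ->
  support p = \bigcup_(b in [set b | in_support (map phi p) (phi b)]) carrier T b.
Proof.
move=> H; rewrite /support; apply/seteqP; split=> x.
  move=> [e /= ep]; rewrite (cub_cl H) => -[b /= le bx]; exists b => //=.
  by rewrite /in_support hasbE has_map; apply/hasP; exists e.
move=> [b /=]; rewrite /in_support hasbE has_map => /hasP[e ep /= le] bx.
by exists e => //=; rewrite (cub_cl H); exists b.
Qed.

Record encodes (U : template_data) (phi : cell U -> cubecell) (d : code) : Prop := Codes {
  co_tail : forall e, dim U e = 1 -> phi (etail U e) = ctail d (phi e);
  co_head : forall e, dim U e = 1 -> phi (ehead U e) = chead d (phi e);
  co_N : phi (north U) = cnorth d;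
  co_S : phi (south U) = csouth d;
  co_WE : map phi (merWE U) = cWE d;
  co_EW : map phi (merEW U) = cEW d;
  co_W : hemiW U = \bigcup_(c in [set c | cW d (phi c)]) carrier U c;
  co_E : hemiE U = \bigcup_(c in [set c | cE d (phi c)]) carrier U c }.

(** * Connected unions of cells and components *)

Lemma connected_between (X : topologicalType) (A B : set X) :
  connected A -> A `<=` B -> B `<=` closure A -> connected B.
Proof.
move=> cA AB BA; apply/connectedP => E [E0 EU sE].
(* If [A] lies in one part of a separation of [B], then so does [B] in the closure of that part,
   which the other, nonempty part must avoid. *)
have key b : A `<=` E b -> False.
  move=> AE; have [x Ex] := E0 (~~ b).
  have cx : closure (E b) x.
    by apply: closureS AE _ _; apply: BA; rewrite EU; case: (b) Ex; [left|right].
  have [h1 h2] := sE.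
  case: b AE Ex cx => _ Ex cx.
    by have : (E false `&` closure (E true)) x by []; rewrite h2.
  by have : (closure (E false) `&` E true) x by []; rewrite h1.
have [] := connected_subset sE _ cA; first by rewrite -EU.
  exact: key.
exact: key.
Qed.

Section Components.
Variables (C : cell_complex) (phi : cell C -> cubecell).
Hypothesis H : cubical phi.
Let cup (P : set (cell C)) : set (space C) := \bigcup_(c in P) carrier C c.

(** The union lies between the upper cell and its closure. *)
Lemma adj_connected b c : le_cell (phi b) (phi c) ->
  connected (carrier C b `|` carrier C c).
Proof.
move=> le; apply: (connected_between (cub_conn H c)) => [x cx|x []].
- by right.
- exact: (sub_closure H b c).2 le x.
- by move=> cx; apply: subset_closure.
Qed.

(** A new cell [k] is incident with a cell [j] already present, so the union gains a connected set
    that overlaps it in [j]. *)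
Lemma grow_connected (A s : seq cubecell) :
  connected (cup [set c | phi c \in s]) ->
  connected (cup [set c | phi c \in grow A s]).
Proof.
elim: A s => //= k A IH s cs; case: ifP => hk; apply: IH => //.
move: hk; rewrite hasbE => /hasP[j js adj].
have [c ck] := cub_surj H k; have [b bj] := cub_surj H j.
have -> : cup [set x | phi x \in k :: s] =
    cup [set x | phi x \in s] `|` (carrier C b `|` carrier C c).
  rewrite [carrier C b]carrier_cup [carrier C c]carrier_cup !cupU; congr cup.
  apply/seteqP; split=> x /=; rewrite inE.
    by case/orP=> [/eqP xk|]; [right; right; apply: (cub_inj H); rewrite ck|left].
  by case=> [->|[->|->]]; rewrite ?orbT ?bj ?ck ?js ?eqxx ?orbT.
apply: connectedU => //.
  have [x bx] := cub_ne H b; exists x; split; last by left.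
  by exists b => //=; rewrite bj.
have {adj} [le|le] : le_cell j k \/ le_cell k j by move: adj; case: ifP; [left|right].
  by apply: adj_connected; rewrite bj ck.
by rewrite setUC; apply: adj_connected; rewrite bj ck.
Qed.

(** The two sets are separated, so a connected subset of the union stays in one of them; being
    connected themselves, they are the maximal ones. *)
Lemma connected_hemis (W E : set (space C)) :
  connected W -> connected E -> W !=set0 -> E !=set0 ->
  W `&` closure E = set0 -> closure W `&` E = set0 ->
  components (W `|` E) = [set W; E].
Proof.
move=> cW cE [w Ww] [e Ee] sW sE.
have sep : separated W E by [].
have comp (x : space C) : (W `|` E) x ->
    connected_component (W `|` E) x `<=` W \/
    connected_component (W `|` E) x `<=` E.
  move=> _; apply: (connected_subset sep (@connected_component_sub _ _ _)).
  exact: component_connected.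
have dis x : W x -> E x -> False.
  by move=> Wx Ex; have : (W `&` E) x by []; rewrite (separated_disjoint sep).
have eW x : W x -> connected_component (W `|` E) x = W.
  move=> Wx; have WEx : (W `|` E) x by left.
  apply/seteqP; split; last first.
    by apply: connected_component_max => // y; left.
  case: (comp x WEx) => // sub; case: (dis x) => //; apply: sub.
  exact: connected_component_refl.
have eE x : E x -> connected_component (W `|` E) x = E.
  move=> Ex; have WEx : (W `|` E) x by right.
  apply/seteqP; split; last first.
    by apply: connected_component_max => // y; right.
  case: (comp x WEx) => // sub; case: (dis x) => //; apply: sub.
  exact: connected_component_refl.
apply/seteqP; split=> A.
  by move=> [x [Wx|Ex] <-]; [left; exact: eW|right; exact: eE].
by move=> [->|->]; [exists w; [left|exact: eW]|exists e; [right|exact: eE]].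
Qed.
End Components.

Lemma ranked_acyclic (T : eqType) (r : rel T) (f : T -> nat) :
  (forall u v, r u v -> f u < f v) -> forall s, cycle r s -> s = [::].
Proof.
move=> lt [//|x p]; rewrite /cycle => cyc; exfalso.
have lt_path q z : path r z q -> q != [::] -> f z < f (last z q).
  elim: q z => //= y q IH z /andP[/lt zy].
  case: q IH => [|w q] IH // yq _; apply: ltn_trans zy _.
  exact: IH.
have := lt_path _ _ cyc; rewrite last_rcons ltnn.
by case: (p) => [|? ?] /(_ isT).
Qed.

(** * From a good code to a template *)

Section Realize.
Variables (U : template_data) (phi : cell U -> cubecell) (d : code).
Hypothesis H : cubical phi.
Hypothesis D : encodes phi d.

Let cup (P : set (cell U)) : set (space U) := \bigcup_(c in P) carrier U c.

Lemma in_support_codes (v : cell U) :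
  carrier U v `<=` support (merWE U) `|` support (merEW U) <->
  in_support (cWE d) (phi v) || in_support (cEW d) (phi v).
Proof.
rewrite !(supportE _ H) (co_WE D) (co_EW D) cupU (sub_cup H) /=.
by split=> [[->|->]|/orP[]]; rewrite ?orbT //; [left|right].
Qed.

Lemma dipath_codes u p v : dipath u p v =
  cell_dipath (ctail d) (chead d) (phi u) (map phi p) (phi v).
Proof.
elim: p u => [|e p IH] u /=; first by rewrite (inj_eq (cub_inj H)).
rewrite (cub_dim H); case: eqP => //= de.
have de' : dim U e = 1 by rewrite (cub_dim H).
by rewrite IH (co_head D de') -(co_tail D de') (inj_eq (cub_inj H)).
Qed.

Lemma arc_codes u v : arc u v =
  has (fun e => (ctail d e == phi u) && (chead d e == phi v)) edges.
Proof.
apply/existsP/hasP => [[e /and3P[/eqP de /eqP te /eqP he]]|[k]].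
  exists (phi e); last by rewrite -(co_tail D de) -(co_head D de) te he !eqxx.
  by rewrite mem_edges -(cub_dim H) de.
have [e <-] := cub_surj H k; rewrite mem_edges -(cub_dim H) => /eqP de.
rewrite -(co_tail D de) -(co_head D de) !(inj_eq (cub_inj H)) => /andP[te he].
by exists e; rewrite de eqxx te he.
Qed.

Lemma hemiW_codes c : carrier U c `<=` hemiW U <-> cW d (phi c).
Proof. by rewrite (co_W D) (sub_cup H). Qed.

Lemma hemiE_codes c : carrier U c `<=` hemiE U <-> cE d (phi c).
Proof. by rewrite (co_E D) (sub_cup H). Qed.

Let edge_mem e : dim U e = 1 -> phi e \in edges.
Proof. by move=> de; rewrite mem_edges -(cub_dim H) de. Qed.

Lemma good_oriented : code_oriented d -> oriented U.
Proof.
move=> /allP ok e de; have /and4P[t0 h0 lt /allP ends] := ok _ (edge_mem de).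
have te := co_tail D de; have he := co_head D de.
split; rewrite ?(cub_dim H) ?te ?he; try exact/eqP.
  by move=> eth; move: lt; rewrite -te -he eth ltnn.
rewrite (bdE H) [carrier U (etail U e)]carrier_cup [carrier U (ehead U e)]carrier_cup.
rewrite cupU; congr cup; apply/seteqP; split=> b /=.
  move=> [le ne]; have := ends _ (mem_cells (phi b)).
  rewrite le (inj_eq (cub_inj H)) (introN eqP ne) /= eq_sym eqb_id.
  by rewrite -te -he !(inj_eq (cub_inj H)) => /orP[] /eqP; [left|right].
move=> bE; have := ends _ (mem_cells (phi b)).
have -> : (phi b == ctail d (phi e)) || (phi b == chead d (phi e)).
  by rewrite -te -he !(inj_eq (cub_inj H)); case: bE => ->; rewrite eqxx ?orbT.
by rewrite eqb_id (inj_eq (cub_inj H)) => /andP[-> /eqP].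
Qed.

Lemma good_acyclic : code_oriented d ->
  forall s : seq (cell U), cycle (@arc U) s -> s = [::].
Proof.
move=> /allP ok; apply: (@ranked_acyclic _ _ (fun u => code_rank d (phi u))).
move=> u v; rewrite arc_codes => /hasP[e ee /andP[/eqP <- /eqP <-]].
by have /and4P[] := ok _ ee.
Qed.

Lemma good_source : code_poles d -> forall v : cell U, is_source v <-> v = north U.
Proof.
move=> /and3P[N00 _ /allP ok] v; split.
  move=> [dv nov]; apply: (cub_inj H); rewrite (co_N D).
  have := ok (phi v); rewrite mem_vertices -(cub_dim H) dv => /(_ isT) /andP[/eqP + _].
  suff -> : all (fun e => chead d e != phi v) edges by move/esym/eqP.
  apply/allP => k ke; apply/negP => hk.
  have [u uk] := cub_surj H (ctail d k).
  have := nov u; rewrite arc_codes => /negP; apply; apply/hasP; exists k => //.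
  by rewrite uk eqxx.
move=> ->; split; first by apply/eqP; rewrite (cub_dim H) (co_N D).
move=> u; rewrite arc_codes (co_N D); apply/hasPn => k ke; rewrite negb_and.
have := ok (cnorth d); rewrite mem_vertices => /(_ N00) /andP[].
by rewrite eqxx eqb_id => /allP/(_ k ke) -> _; rewrite orbT.
Qed.

Lemma good_sink : code_poles d -> forall v : cell U, is_sink v <-> v = south U.
Proof.
move=> /and3P[_ S0 /allP ok] v; split.
  move=> [dv nov]; apply: (cub_inj H); rewrite (co_S D).
  have := ok (phi v); rewrite mem_vertices -(cub_dim H) dv => /(_ isT) /andP[_ /eqP].
  suff -> : all (fun e => ctail d e != phi v) edges by move/esym/eqP.
  apply/allP => k ke; apply/negP => hk.
  have [u uk] := cub_surj H (chead d k).
  have := nov u; rewrite arc_codes => /negP; apply; apply/hasP; exists k => //.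
  by rewrite uk eqxx hk.
move=> ->; split; first by apply/eqP; rewrite (cub_dim H) (co_S D).
move=> u; rewrite arc_codes (co_S D); apply/hasPn => k ke; rewrite negb_and.
have := ok (csouth d); rewrite mem_vertices => /(_ S0) /andP[_].
by rewrite eqxx eqb_id => /allP/(_ k ke) ->.
Qed.

Lemma good_meridians : code_meridians d ->
  [/\ dipath (north U) (merWE U) (south U), dipath (north U) (merEW U) (south U) &
    support (merWE U) `&` support (merEW U) =
      carrier U (north U) `|` carrier U (south U)].
Proof.
move=> /and3P[pWE pEW /allP meet].
rewrite !dipath_codes (co_N D) (co_S D) (co_WE D) (co_EW D); split=> //.
rewrite !(supportE _ H) (cupI H) [carrier U (north U)]carrier_cup.
rewrite [carrier U (south U)]carrier_cup cupU (co_WE D) (co_EW D); congr cup.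
apply/seteqP; split=> b /=; have := meet _ (mem_cells (phi b)).
  by move=> /eqP + [h1 h2]; rewrite h1 h2 -(co_N D) -(co_S D)
    !(inj_eq (cub_inj H)) => /esym/orP[] /eqP; [left|right].
rewrite -(co_N D) -(co_S D) !(inj_eq (cub_inj H)) => /eqP + bE.
have -> : (b == north U) || (b == south U) by case: bE => ->; rewrite eqxx ?orbT.
by move/andP.
Qed.

Lemma conn_cells_connected (h : cubecell -> bool) : conn_cells h ->
  connected (cup [set c | h (phi c)]) /\ cup [set c | h (phi c)] !=set0.
Proof.
rewrite /conn_cells; case E: (hemi_cells h) => [//|k A] /andP[/allP sub /allP sub'].
set s := iter _ _ _ in sub sub'.
(* The two tests of [conn_cells] are the two inclusions: the growth from one cell reaches all of [h]
   and never leaves it. *)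
have -> : [set c | h (phi c)] = [set c | phi c \in s].
  apply/seteqP; split=> c /= hc; last exact: sub'.
  by apply: sub; rewrite -E mem_filter hc mem_cells.
have [c0 c0k] := cub_surj H k.
split.
  rewrite /s; elim: 4 => [|n IH]; last by rewrite iterS; apply: grow_connected.
  have -> : [set c | phi c \in iter 0 (grow (k :: A)) [:: k]] = [set c0].
    apply/seteqP; split=> c /=; rewrite inE.
      by rewrite -c0k => /eqP/(cub_inj H).
    by move=> ->; rewrite c0k.
  rewrite /cup bigcup_set1; exact: (cub_conn H).
have [x cx] := cub_ne H c0; exists x; exists c0 => //=; rewrite c0k.
by apply: sub; rewrite mem_head.
Qed.

(** No cell of one hemisphere is incident with a cell of the other, so each is disjoint from the
    closure of the other and [connected_hemis] applies. *)
Lemma good_components : code_hemis d ->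
  hemiW U <> hemiE U /\
  components (cup [set c | dim_cell (phi c) < 3 /\
     ~~ (in_support (cWE d) (phi c) || in_support (cEW d) (phi c))]) = [set hemiW U; hemiE U].
Proof.
rewrite /code_hemis => /and4P[hW hE /allP cover /allP dis].
have [conW neW] := conn_cells_connected hW; have [conE neE] := conn_cells_connected hE.
have disj b c : cW d (phi b) -> cE d (phi c) ->
    le_cell (phi b) (phi c) || le_cell (phi c) (phi b) = false.
  move=> Wb Ec; have /allP/(_ _ (mem_cells (phi c))) := dis _ (mem_cells (phi b)).
  by rewrite Wb Ec implybF => /negbTE.
rewrite (co_W D) (co_E D); split.
  move=> /(cup_inj H) WE; have [x [c /= Wc _]] := neW.
  have : [set c | cE d (phi c)] c by rewrite -WE.
  by move=> /= Ec; have := disj _ _ Wc Ec; rewrite le_cell_refl.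
rewrite (_ : cup _ = cup [set c | cW d (phi c)] `|` cup [set c | cE d (phi c)]).
  apply: connected_hemis => //.
    rewrite (closure_cup H) (cupI H); apply/seteqP; split => // x [c [/= Wc [b /= Eb le]] _].
    by have := disj _ _ Wc Eb; rewrite le.
  rewrite (closure_cup H) (cupI H); apply/seteqP; split => // x [c [[b /= Wb le] /= Ec] _].
  by have := disj _ _ Wb Ec; rewrite le orbT.
rewrite cupU; congr cup; apply/seteqP; split=> c /=; have := cover _ (mem_cells (phi c)).
  by move=> /eqP + [h1 h2]; rewrite h1 h2 => /esym/orP.
by move=> /eqP + /orP h; rewrite h => /andP.
Qed.

Lemma good_local : code_hemis d -> local_ok d ->
  forall e v : cell U, dim U e = 1 -> meridian_vertex v ->
        carrier U v `<=` bd e ->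
        (carrier U e `<=` hemiW U -> ehead U e = v) /\
        (carrier U e `<=` hemiE U -> etail U e = v).
Proof.
rewrite /code_hemis => /and4P[_ _ _ /allP dis]; rewrite /local_ok allbE => /allP loc e v de.
move=> [dv vN vS vsup] /(sub_bd H)[le _].
have := loc (phi v); rewrite mem_vertices -(cub_dim H) dv => /(_ isT).
case: eq_cellP => [|_].
  by rewrite -(co_N D) => /(cub_inj H).
case: eq_cellP => [|_].
  by rewrite -(co_S D) => /(cub_inj H).
move/in_support_codes: vsup; rewrite /orb => ->; rewrite allbE => /allP/(_ _ (edge_mem de)).
rewrite le hemiW_codes hemiE_codes; case: ifP => [We /eq_cellP|nWe].
  rewrite -(co_head D de) => /(cub_inj H) ->; split=> // Ee.
  have /allP/(_ _ (mem_cells (phi e))) := dis _ (mem_cells (phi e)).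
  by rewrite We Ee le_cell_refl.
by move=> h; split=> // Ee; move: h; rewrite Ee => /eq_cellP;
  rewrite -(co_tail D de) => /(cub_inj H).
Qed.

Lemma good_overlap (p : seq (cell U)) :
  all (fun e => dim U e == 1) p ->
  overlap_ok d (map phi p) -> code_unique d (map phi p) -> overlap p.
Proof.
case: p => [//|e0 p] /allP dp.
move=> /overlap_okP[kf [kg [ke [+ + + [] + + + [] + + +]]]].
have [f <-{kf}] := cub_surj H kf; have [g <-{kg}] := cub_surj H kg.
move=> ff gg; rewrite -[_ :: map _ _]/(map phi (e0 :: p)) => /mapP[e ep ->].
move=> Wf lf le_coord Eg lg le2; rewrite /code_unique -[head _ _]/(phi e0).
have -> : last corner (map phi (e0 :: p)) = phi (last e0 p) by rewrite /= last_map.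
move=> /andP[/allP uf /allP ug].
have df : dim U f = 2 by apply/eqP; rewrite (cub_dim H) -mem_faces.
have dg : dim U g = 2 by apply/eqP; rewrite (cub_dim H) -mem_faces.
have ne b c : b \in e0 :: p -> dim U c = 2 -> b <> c.
  by move=> /dp /eqP db dc bc; move: db; rewrite bc dc.
rewrite last_map in lg.
have lp : last e0 p \in e0 :: p by exact: mem_last.
exists e0, (last e0 p), f, g; split => //.
- by rewrite lastI rev_rcons.
- split; first split => //.
  + by apply/hemiW_codes.
  + by apply/(sub_bd H); split=> //; apply: ne; rewrite ?mem_head.
  move=> f' [df' /hemiW_codes Wf' /(sub_bd H)[lf' _]].
  have f'f : phi f' \in faces by rewrite mem_faces -(cub_dim H) df'.
  have /allP/(_ _ f'f) := uf _ ff.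
  by rewrite Wf lf Wf' lf' => /eqP/(cub_inj H).
- split; first split => //.
  + by apply/hemiE_codes.
  + by apply/(sub_bd H); split=> //; apply: ne.
  move=> f' [df' /hemiE_codes Ef' /(sub_bd H)[lf' _]].
  have f'f : phi f' \in faces by rewrite mem_faces -(cub_dim H) df'.
  have /allP/(_ _ f'f) := ug _ gg.
  by rewrite Eg lg Ef' lf' => /eqP/(cub_inj H).
- exists e => // x ex; split.
    have /(sub_bd H) : le_cell (phi e) (phi f) /\ e <> f by split=> //; apply: ne.
    exact.
  have /(sub_bd H) : le_cell (phi e) (phi g) /\ e <> g by split=> //; apply: ne.
  exact.
Qed.

Lemma dipath_edges u p v : dipath u p v -> all (fun e => dim U e == 1) p.
Proof. by elim: p u => //= e p IH u /and3P[-> _ /IH]. Qed.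

Lemma good_code_template (R : realType) :
  regular_CW R U -> good_code d -> is_3cell_template R U.
Proof.
move=> reg /and5P[gor gpo gme ghe /and5P[gl o1 o2 u1 u2]]; split=> //.
have [B Btop] := cub_surj H (None, None, None).
have leO c : le_cell (phi c) (phi B) by rewrite Btop /le_cell; case: (phi c) => [[? ?] ?].
have [p1 p2 meet] := good_meridians gme.
exists B; split.
- split; first by rewrite (cub_dim H) Btop.
  rewrite (cub_cl H) /total; congr (\bigcup_(_ in _) _).
  by apply/seteqP; split=> c /= _ //; exact: leO.
- split=> //; split.
  + exact: good_oriented.
  + exact: good_acyclic.
  + exact: good_source.
  + exact: good_sink.
- have [neq comp] := good_components ghe; split=> //; rewrite -comp; congr components.
  rewrite (bdE H) !(supportE _ H) cupU (cupD H); congr cup; apply/seteqP.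
  have dO (c : cell U) : dim_cell (phi c) < 3 <-> c <> B.
    split=> [lt cO|nO]; first by move: lt; rewrite cO Btop.
    have : phi c <> (None, None, None) by move=> cO; apply: nO; apply: (cub_inj H); rewrite cO.
    by case: (phi c) => [[[[]|] [[]|]] [[]|]].
  split=> c /=; rewrite (co_WE D) (co_EW D).
    by move=> [[_ /dO lt] ns]; split=> //; apply/negP => /orP.
  by move=> [/dO lt /negP ns]; split; [split|move=> /orP].
- exact: good_local.
- by split; apply: good_overlap; rewrite ?(co_WE D) ?(co_EW D) //;
    [exact: (dipath_edges p1)|exact: (dipath_edges p2)].
Qed.

End Realize.

(** * Topology of the solid cube *)

Local Open Scope ring_scope.

Lemma rV_continuous (X : topologicalType) (R : realType) n (f : X -> 'rV[R]_n) :
  (forall i, continuous (fun x => f x 0 i)) -> continuous f.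
Proof.
move=> cf x A [P Px PA]; apply: filterS PA _.
have : \forall y \near x, forall i : 'I_n, P 0 i (f y 0 i).
  by apply: filter_forall => i; apply: (cf i x); exact: Px.
by apply: filterS => y Py i j; rewrite !ord1.
Qed.

Lemma closure_prod (R : realType) n (A : 'I_n -> set R) :
  closure [set x : 'rV[R]_n | forall i, A i (x 0 i)] =
  [set x : 'rV[R]_n | forall i, closure (A i) (x 0 i)].
Proof.
apply/seteqP; split=> x /= cx.
  move=> i V Vx; have [|y [/= Ay Vy]] := cx (fun y : 'rV[R]_n => V (y 0 i)).
    exact: (@coord_continuous R 1 n 0 i x V Vx).
  by exists (y 0 i).
move=> V [P Px PV].
have /choice [y yP] : forall i, exists t, A i t /\ P 0 i t.
  by move=> i; have [t [At Pt]] := cx i _ (Px 0 i); exists t.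
exists (\row_i y i); split; first by move=> i; rewrite mxE; have [] := yP i.
by apply: PV => i j; rewrite ord1 mxE; have [] := yP j.
Qed.

Section Interval.
Variable R : realType.
Implicit Types (a b : option bool) (t : R).

Definition sgb (b : bool) : R := if b then 1 else -1.

Definition in1 a : set R :=
  [set t | match a with None => -1 < t < 1 | Some b => t = sgb b end].
Definition cl1 a : set R :=
  [set t | match a with None => -1 <= t <= 1 | Some b => t = sgb b end].

Lemma in1_inj a b t : in1 a t -> in1 b t -> a = b.
Proof.
by case: a b => [[]|] [[]|]; rewrite /in1 /= /sgb => h1 h2 //; exfalso;
  lra.
Qed.

Lemma cl1P a t : cl1 a t <-> exists2 b, le_coord b a & in1 b t.
Proof.
split; last first.
  by case: a => [[]|] [[[]|]] //= _; rewrite /in1 /cl1 /= /sgb => h; lra.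
case: a => [[]|] /=; rewrite /cl1 /= /sgb => h; first by exists (Some true).
  by exists (Some false).
have [->|n1] := eqVneq t 1; first by exists (Some true).
have [->|n2] := eqVneq t (-1); first by exists (Some false).
exists None => //; rewrite /in1 /= !lt_neqAle n1 [-1 == _]eq_sym n2 //=.
Qed.

Lemma closure_in1 a : closure (in1 a) = cl1 a.
Proof.
apply/seteqP; split=> t.
  have cl : closed (cl1 a).
    case: a => [b|]; first exact: closed_eq.
    rewrite (_ : cl1 None = [set x | -1 <= x] `&` [set x | x <= 1]).
      by apply: closedI; [exact: closed_ge|exact: closed_le].
    by apply/seteqP; split=> x /= => [/andP[]|[? ?]]; [|apply/andP].
  move/closure_id: cl => ->; apply: closureS => x.
  by case: a => [b|] //=; rewrite /in1 /cl1 /= => /andP[? ?]; rewrite !ltW.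
case: a => [b|] ht; first exact: subset_closure.
rewrite /cl1 /= in ht; move=> V [e /= e0 eV].
(* The approximating point is $(1-r)t$: shrinking towards 0 by a factor strictly between 0 and 1
   enters the open interval, and it moves [t] by at most $r < e$. *)
pose r : R := Num.min 2^-1 (e / 2).
have [r0 r1 re] : [/\ 0 < r, r < 1 & r < e].
  rewrite /r !lt_min !gt_min; split; first by apply/andP; split; lra.
    by apply/orP; left; lra.
  by apply/orP; right; lra.
exists (t - t * r); split.
  by rewrite /in1 /=; nra.
apply: eV; rewrite /= opprB addrC subrK normrM (gtr0_norm r0).
by rewrite (le_lt_trans _ re)// ler_piMl ?(ltW r0)// ler_norml; lra.
Qed.
End Interval.

Definition to_triple (s : {ffun 'I_3 -> option bool}) : cubecell :=
  (s ord0, s (inord 1), s (inord 2)).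
Definition of_triple (k : cubecell) : {ffun 'I_3 -> option bool} :=
  [ffun i : 'I_3 => crd k i].

Lemma crd_to_triple (s : {ffun 'I_3 -> option bool}) (i : 'I_3) : crd (to_triple s) i = s i.
Proof.
by case: i => [[|[|[|//]]] lt] /=; congr (s _); apply: val_inj; rewrite //= inordK.
Qed.

Lemma of_tripleK : cancel of_triple to_triple.
Proof. by case=> [[a b] c]; rewrite /to_triple !ffunE !inordK. Qed.

Lemma to_tripleK : cancel to_triple of_triple.
Proof. by move=> s; apply/ffunP => i; rewrite ffunE crd_to_triple. Qed.

Lemma le_to_triple (s t : {ffun 'I_3 -> option bool}) :
  le_cell (to_triple s) (to_triple t) <-> forall i, le_coord (s i) (t i).
Proof.
rewrite le_cellE; split=> [/and3P[h0 h1 h2] i|le].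
  rewrite -!crd_to_triple; case: i => [[|[|[|//]]] lt] //=.
by rewrite /to_triple /= !le.
Qed.

Lemma dim_to_triple (s : {ffun 'I_3 -> option bool}) :
  #|[pred i : 'I_3 | s i == None]| = dim_cell (to_triple s).
Proof.
rewrite -sum1_card big_mkcond /= !big_ord_recl big_ord0 /dim_cell /to_triple /=.
rewrite !inE.
have -> : lift ord0 ord0 = inord 1 :> 'I_3 by apply: val_inj; rewrite /= inordK.
have -> : lift ord0 (lift ord0 ord0) = inord 2 :> 'I_3 by apply: val_inj; rewrite /= inordK.
by rewrite addn0 addnA; case: (s _) => [?|]; case: (s _) => [?|]; case: (s _).
Qed.

Section Cube.
Variable R : realType.
Let Q := solid_cube R.

Lemma carrierE (s : cell Q) :
  carrier Q s = [set x : 'rV[R]_3 | forall i, in1 (s i) (x 0 i)].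
Proof.
by apply/seteqP; split=> x /= h i; have := h i; rewrite /in1 /=; case: (s i).
Qed.

Lemma carrierP (s : cell Q) x : carrier Q s x <-> forall i, in1 (s i) (x 0 i).
Proof. by rewrite carrierE. Qed.

Lemma closure_carrierE (s : cell Q) :
  closure (carrier Q s) = [set x : 'rV[R]_3 | forall i, cl1 (s i) (x 0 i)].
Proof.
rewrite carrierE [LHS](closure_prod (fun i => in1 (s i))).
apply/seteqP; split=> x /= h i.
  by rewrite -closure_in1.
by rewrite closure_in1.
Qed.

(** The cell is convex, hence the union of the segments from its centre [m], all of which contain
    [m]. *)
Lemma carrier_connected (s : cell Q) : connected (carrier Q s).
Proof.
rewrite carrierE.
pose m : 'rV[R]_3 := \row_i (if s i is Some b then sgb R b else 0).
have im i : in1 (s i) (m 0 i).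
  by rewrite mxE /in1 /=; case: (s i) => //; lra.
pose g (x : 'rV[R]_3) (t : R) : 'rV[R]_3 := \row_i ((1 - t) * m 0 i + t * x 0 i).
have -> : [set x : 'rV[R]_3 | forall i, in1 (s i) (x 0 i)] =
    \bigcup_(x in [set x : 'rV[R]_3 | forall i, in1 (s i) (x 0 i)])
      (g x @` `[0, 1]).
  apply/seteqP; split=> x.
    move=> hx; exists x => //; exists 1; first by rewrite /= in_itv /= ler01 lexx.
    by apply/rowP => i; rewrite !mxE subrr mul0r add0r mul1r.
  move=> [y hy [t]]; rewrite /= in_itv /= => /andP[t0 t1] <- i.
  rewrite /g mxE; move: (m 0 i) (y 0 i) (im i) (hy i) => a b.
  rewrite /in1 /=; case: (s i) => [c -> ->|].
    by rewrite -mulrDl subrK mul1r.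
  move=> /andP[a1 a2] /andP[b1 b2].
  (* For $t<1$ the strict bounds come from the centre, which has the positive weight $1-t$; at $t=1$
     they are those of [b]. *)
  have [t_lt1|t_ge1] := ltrP t 1; last first.
    have -> : t = 1 by apply/le_anti/andP; split.
    by rewrite subrr mul0r mul1r add0r b1 b2.
  have u0 : 0 < 1 - t by lra.
  have p1 : 0 <= t * (b + 1) by apply: mulr_ge0 => //; lra.
  have p2 : 0 <= t * (1 - b) by apply: mulr_ge0 => //; lra.
  have p3 : 0 < (1 - t) * (a + 1) by apply: mulr_gt0 => //; lra.
  have p4 : 0 < (1 - t) * (1 - a) by apply: mulr_gt0 => //; lra.
  by apply/andP; split; nra.
apply: bigcup_connected.
  exists m => x hx; exists 0; first by rewrite /= in_itv /= ler01 lexx.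
  by apply/rowP => i; rewrite !mxE subr0 mul1r mul0r addr0.
move=> x _; apply: connected_continuous_connected; first exact: segment_connected.
apply: continuous_subspaceT; apply: rV_continuous => i.
rewrite (_ : (fun t => _) = (fun t => (1 - t) * m 0 i + t * x 0 i)); last first.
  by apply/funext => t; rewrite mxE.
move=> t; apply: cvgD; apply: cvgM; try exact: cvg_cst; try exact: cvg_id.
by apply: cvgB; [exact: cvg_cst|exact: cvg_id].
Qed.

Lemma cube_cubical : @cubical Q to_triple.
Proof.
split.
- by exists of_triple; [exact: to_tripleK|exact: of_tripleK].
- exact: dim_to_triple.
- move=> s t _ _ [x []]; rewrite !carrierE => hs ht.
  by apply/ffunP => i; apply: in1_inj (hs i) (ht i).
- exact: carrier_connected.
- move=> s; exists (\row_i (if s i is Some b then sgb R b else 0)).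
  by rewrite carrierE => i; rewrite mxE /in1 /=; case: (s i) => //; lra.
- move=> s; rewrite closure_carrierE; apply/seteqP; split=> x.
    move=> hx; have /choice[t tP] : forall i, exists b, le_coord b (s i) /\ in1 b (x 0 i).
      by move=> i; have /cl1P[b] := hx i; exists b.
    exists ([ffun i => t i] : cell Q).
      by apply/le_to_triple => i; rewrite ffunE; have [] := tP i.
    by apply/carrierP => i; rewrite ffunE; have [] := tP i.
  move=> [t /= /le_to_triple le] /carrierP hx i.
  by apply/cl1P; exists (t i).
Qed.
End Cube.

(* Both the Euclidean norm and the maximum norm are gauges; rescaling along rays takes
   the unit ball of one to that of the other. *)
Record gauge (R : realType) n (p : 'rV[R]_n -> R) : Prop := Gauge {
  gauge_cont : continuous p;
  gaugeZ : forall (a : R) (x : 'rV[R]_n), 0 <= a -> p (a *: x) = a * p x;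
  gauge_coord : forall (x : 'rV[R]_n) i, `|x 0 i| <= p x }.

(** The factor is chosen so that [q] of the image is [p x], see [gauge_radial]. At the origin it is
    a division by zero, but the image is 0 for any factor. *)
Definition radial (R : realType) n (p q : 'rV[R]_n -> R) (x : 'rV[R]_n) :=
  (p x / q x) *: x.

Section Gauge.
Variables (R : realType) (n : nat) (p q : 'rV[R]_n -> R).
Hypothesis gp : gauge p.

Lemma gauge0 : p 0 = 0.
Proof. by rewrite -(scale0r 0) (gaugeZ gp) // mul0r. Qed.

Lemma gauge_gt0 x : x != 0 -> 0 < p x.
Proof.
move=> x0; have [i xi] : exists i, x 0 i != 0.
  apply: contrapT => h; move/eqP: x0; apply; apply/rowP => i; rewrite mxE.
  by apply: contrapT => /eqP xi; apply: h; exists i.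
by apply: lt_le_trans (gauge_coord gp x i); rewrite normr_gt0.
Qed.

Lemma radial0 : radial p q 0 = 0.
Proof. by rewrite /radial scaler0. Qed.
End Gauge.

Section Radial.
Variables (R : realType) (n : nat) (p q : 'rV[R]_n -> R).
Hypotheses (gp : gauge p) (gq : gauge q).

Lemma radial_coef_ge0 x : 0 <= p x / q x.
Proof.
have [->|x0] := eqVneq x 0; first by rewrite (gauge0 gp) mul0r.
by rewrite divr_ge0 // ltW // gauge_gt0.
Qed.

Lemma gauge_radial x : q (radial p q x) = p x.
Proof.
rewrite /radial (gaugeZ gq) ?radial_coef_ge0 //.
have [->|x0] := eqVneq x 0; first by rewrite (gauge0 gp) !mul0r.
by rewrite divfK // gt_eqF // gauge_gt0.
Qed.

Lemma radial_continuous : continuous (radial p q).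
Proof.
move=> x; have [->|x0] := eqVneq x 0; last first.
  have cM : {for x, continuous (p \* (fun y => (q y)^-1))}.
    apply: continuousM; first exact: (gauge_cont gp).
    by apply: continuousV; [rewrite gt_eqF // gauge_gt0|exact: (gauge_cont gq)].
  exact (continuousZ cM (@cvg_id _ (nbhs x))).
have FF : Filter (nbhs (0 : 'rV[R]_n)) by exact: nbhs_filter.
(* The factor need not converge at the origin, but each coordinate of the image of [y] is bounded by
   its [q]-value, which is [p y] and tends to 0. *)
rewrite /continuous_at radial0; apply/cvgr0Pnorm_le => e e0.
have : \forall y \near (0 : 'rV[R]_n), `|p y| <= e.
  by have := @gauge_cont _ _ _ gp 0; rewrite /continuous_at (gauge0 gp) => /cvgr0Pnorm_le; exact.
apply: filterS => y pe; apply: le_trans pe.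
rewrite [`|radial p q y|]mx_normrE; apply/bigmax_leP; split => // -[i j] _ /=.
by rewrite ord1 (le_trans (gauge_coord gq _ _)) // gauge_radial ler_norm.
Qed.
End Radial.

Lemma radialK (R : realType) n (p q : 'rV[R]_n -> R) :
  gauge p -> gauge q -> cancel (radial p q) (radial q p).
Proof.
move=> gp gq x; have [->|x0] := eqVneq x 0; first by rewrite !radial0.
have px := gauge_gt0 gp x0; have qx := gauge_gt0 gq x0.
rewrite [LHS]/radial (gauge_radial gp gq) /radial (gaugeZ gp) ?radial_coef_ge0 //.
rewrite scalerA -[RHS]scale1r; congr (_ *: _); field.
by rewrite !gt_eqF.
Qed.

Definition euclid (R : realType) n (x : 'rV[R]_n) : R := Num.sqrt (\sum_i x 0 i ^+ 2).

Section Euclid.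
Variables (R : realType) (n : nat).
Implicit Types x : 'rV[R]_n.

Lemma sumsq_ge0 x : 0 <= \sum_i x 0 i ^+ 2.
Proof. by apply: sumr_ge0 => i _; exact: sqr_ge0. Qed.

Lemma euclid_continuous : continuous (@euclid R n).
Proof.
move=> x; apply: continuous_comp; last exact: sqrt_continuous.
apply: continuous_big; first exact: add_continuous.
move=> i _ y; apply: (@continuous_comp _ _ _ (fun y : 'rV[R]_n => y 0 i) (fun t => t ^+ 2)).
  exact: coord_continuous.
exact: exprn_continuous.
Qed.

Lemma euclidZ (a : R) x : 0 <= a -> euclid (a *: x) = a * euclid x.
Proof.
move=> a0; rewrite /euclid; under eq_bigr do rewrite mxE exprMn.
by rewrite -mulr_sumr sqrtrM ?sqr_ge0 // sqrtr_sqr ger0_norm.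
Qed.

Lemma euclid_coord x i : `|x 0 i| <= euclid x.
Proof.
rewrite -sqrtr_sqr ler_sqrt ?sumsq_ge0 // (bigD1 i) //= lerDl.
by apply: sumr_ge0 => j _; exact: sqr_ge0.
Qed.

Lemma norm_coord x i : `|x 0 i| <= `|x|.
Proof.
rewrite [`|x|]mx_normrE.
by have := @le_bigmax _ _ _ 0 (fun ij : 'I_1 * 'I_n => `|x ij.1 ij.2|) (0, i).
Qed.

Lemma gauge_euclid : gauge (@euclid R n).
Proof. by split; [exact: euclid_continuous|exact: euclidZ|exact: euclid_coord]. Qed.

Lemma gauge_norm : gauge (fun x => `|x|).
Proof.
split; [exact: norm_continuous| |exact: norm_coord].
by move=> a x a0; rewrite normrZ ger0_norm.
Qed.

Lemma norm_le1 x : `|x| <= 1 <-> forall i, `|x 0 i| <= 1.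
Proof.
split=> [h i|h]; first exact: le_trans (norm_coord x i) h.
by rewrite [`|x|]mx_normrE; apply/bigmax_leP; split=> // -[i j] _ /=; rewrite ord1.
Qed.

Lemma norm_lt1 x : `|x| < 1 <-> forall i, `|x 0 i| < 1.
Proof.
split=> [h i|h]; first exact: le_lt_trans (norm_coord x i) h.
by rewrite [`|x|]mx_normrE; apply/bigmax_ltP; split=> // -[i j] _ /=; rewrite ord1.
Qed.
End Euclid.

(** * Characteristic maps of the cells of the cube *)

Section Regular.
Variable R : realType.
Let Q := solid_cube R.

Lemma euclid_le1 n (x : 'rV[R]_n) : @unit_cball R n x <-> euclid x <= 1.
Proof.
rewrite /unit_cball /euclid /= -{2}[1]sqrtr1 ler_sqrt //.
Qed.

Lemma euclid_lt1 n (x : 'rV[R]_n) : @unit_oball R n x <-> euclid x < 1.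
Proof.
rewrite /unit_oball /euclid /= -{2}[1]sqrtr1 ltr_sqrt //.
Qed.

Section Cell.
Variable s : cell Q.
Let A := [pred i : 'I_3 | s i == None].

(* The sum has at most one term. *)
Definition face_emb (z : 'rV[R]_#|A|) : 'rV[R]_3 :=
  \row_i (if s i is Some b then sgb R b
          else \sum_(j < #|A| | enum_val j == i) z 0 j).
Definition face_proj (y : 'rV[R]_3) : 'rV[R]_#|A| := \row_j y 0 (enum_val j).

Lemma face_embK : cancel face_emb face_proj.
Proof.
move=> z; apply/rowP => j; rewrite !mxE.
have /eqP -> : s (enum_val j) == None by have := enum_valP j.
by rewrite (eq_bigl (pred1 j)) ?big_pred1_eq // => k /=; rewrite (inj_eq enum_val_inj).
Qed.

Lemma free_index i : s i = None -> exists j : 'I_#|A|, enum_val j = i.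
Proof.
move=> si; have iA : i \in A by rewrite inE si.
by exists (enum_rank_in iA i); rewrite enum_rankK_in.
Qed.

Lemma face_emb_free z (j : 'I_#|A|) : face_emb z 0 (enum_val j) = z 0 j.
Proof. by rewrite -[RHS](congr1 (fun y : 'rV[R]_#|A| => y 0 j) (face_embK z)) [RHS]mxE. Qed.

Lemma face_emb_carrier (z : 'rV[R]_#|A|) : carrier Q s (face_emb z) <-> `|z| < 1.
Proof.
rewrite norm_lt1; split=> [/carrierP h j|h].
  have := h (enum_val j); rewrite face_emb_free /in1 /=.
  have /eqP -> : s (enum_val j) == None by have := enum_valP j.
  by rewrite ltr_norml.
apply/carrierP => i; rewrite /in1 /=; case si : (s i) => [b|].
  by rewrite mxE si.
have [j <-] := free_index si.
by rewrite face_emb_free -ltr_norml; exact: h.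
Qed.

Lemma face_emb_closure (z : 'rV[R]_#|A|) :
  closure (carrier Q s) (face_emb z) <-> `|z| <= 1.
Proof.
rewrite closure_carrierE norm_le1; split=> [h j|h].
  have := h (enum_val j); rewrite face_emb_free /cl1 /=.
  have /eqP -> : s (enum_val j) == None by have := enum_valP j.
  by rewrite ler_norml.
move=> i; rewrite /cl1 /=; case si : (s i) => [b|].
  by rewrite mxE si.
have [j <-] := free_index si.
by rewrite face_emb_free -ler_norml; exact: h.
Qed.

Lemma face_projK y : closure (carrier Q s) y -> face_emb (face_proj y) = y.
Proof.
rewrite closure_carrierE => h; apply/rowP => i; rewrite mxE.
case si : (s i) => [b|]; first by have := h i; rewrite si.
have [j <-] := free_index si.
rewrite (eq_bigl (pred1 j)) ?big_pred1_eq ?mxE // => k /=.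
by rewrite (inj_eq enum_val_inj).
Qed.

Lemma face_emb_continuous : continuous face_emb.
Proof.
apply: rV_continuous => i; rewrite /face_emb.
under eq_fun do rewrite mxE.
case: (s i) => [b|]; first exact: cst_continuous.
apply: continuous_big; first exact: add_continuous.
by move=> j _ z; exact: coord_continuous.
Qed.

Lemma face_proj_continuous : continuous face_proj.
Proof.
apply: rV_continuous => i; rewrite /face_proj.
under eq_fun do rewrite mxE.
by move=> z; exact: coord_continuous.
Qed.

(** The closed cell is a ball for the maximum norm in its free coordinates. The characteristic map
    rescales the Euclidean ball to this one and then fills in the fixed coordinates. *)
Lemma cell_ball : exists chi : 'rV[R]_(dim Q s) -> space Q,
  homeo_on (@unit_cball R (dim Q s)) (closure (carrier Q s)) chi /\
  chi @` (@unit_oball R (dim Q s)) = carrier Q s.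
Proof.
pose n := #|A|; pose e := @euclid R n; pose N (x : 'rV[R]_n) := `|x|.
have ge : gauge e := gauge_euclid R n; have gN : gauge N := gauge_norm R n.
exists (face_emb \o radial e N); split.
  exists (radial N e \o face_proj); split.
  - move=> x /euclid_le1 x1; split; last by rewrite /= face_embK radialK.
    by apply/face_emb_closure; rewrite -[`|_|]/(N _) gauge_radial.
  - move=> y cy; split; last by rewrite /= radialK // face_projK.
    apply/euclid_le1; rewrite -[euclid _]/(e _) gauge_radial //.
    by apply/face_emb_closure; rewrite face_projK.
  - apply: continuous_subspaceT => x; apply: continuous_comp.
      exact: radial_continuous.
    exact: face_emb_continuous.
  - apply: continuous_subspaceT => x; apply: continuous_comp.
      exact: face_proj_continuous.
    exact: radial_continuous.
apply/seteqP; split=> x.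
  move=> [y /euclid_lt1 y1 <-]; apply/face_emb_carrier.
  by rewrite -[`|_|]/(N _) gauge_radial.
move=> cx; have ccx := subset_closure cx.
exists (radial N e (face_proj x)); last by rewrite /= radialK // face_projK.
apply/euclid_lt1; rewrite -[euclid _]/(e _) gauge_radial //.
by apply/face_emb_carrier; rewrite face_projK.
Qed.
End Cell.

End Regular.

(** The dimension is a sum over coordinates, each term monotone; equal sums force equal terms, and
    comparable coordinates of equal dimension are equal. *)
Lemma dim_cell_lt b c : le_cell b c -> b != c -> (dim_cell b < dim_cell c)%N.
Proof.
have d1 x y : le_coord x y ->
    (dim_coord x <= dim_coord y)%N && ((dim_coord x == dim_coord y) ==> (x == y)).
  by case: x y => [[]|] [[]|].
move: b c => [[a0 a1] a2] [[b0 b1] b2].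
rewrite le_cellE /dim_cell /= => /and3P[/d1/andP[l0 e0] /d1/andP[l1 e1] /d1/andP[l2 e2]].
apply: contraNT; rewrite -leqNgt => le.
have [h0 h1 h2] : [/\ dim_coord a0 = dim_coord b0,
    dim_coord a1 = dim_coord b1 & dim_coord a2 = dim_coord b2].
  move: l0 l1 l2 le; move: (dim_coord a0) (dim_coord a1) (dim_coord a2)
    (dim_coord b0) (dim_coord b1) (dim_coord b2).
  by move=> *; split; lia.
move: e0 e1 e2; rewrite h0 h1 h2 !eqxx /= => /eqP -> /eqP -> /eqP ->.
by rewrite eqxx.
Qed.

Lemma cubical_bd (C : cell_complex) (phi : cell C -> cubecell) (c : cell C) :
  cubical phi -> subcomplex (bd c) /\ bd c `<=` @skeleton_below C (dim C c).
Proof.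
move=> H; rewrite (bdE H); split; last first.
  move=> x [b [le ne] bx]; exists b => //=.
  rewrite !(cub_dim H); apply: dim_cell_lt => //; apply/eqP => e; apply: ne.
  exact: (cub_inj H).
split; last by eexists.
apply/closure_id; rewrite (closure_cup H); congr (\bigcup_(_ in _) _).
apply/seteqP; split=> b /=.
  by move=> h; exists b => //; exact: le_cell_refl.
move=> [a [le ne] le']; split; first exact: le_cell_trans le' le.
move=> bc; subst b; apply: ne; apply: (cub_inj H); exact: le_cell_anti.
Qed.

Lemma cube_regular (R : realType) : regular_CW R (solid_cube R).
Proof.
split.
- exact: (@norm_hausdorff R 'rV[R]_3).
- exact: cub_disj (cube_cubical R).
- exact: cell_ball.
- by move=> c; exact: cubical_bd (cube_cubical R).
Qed.

(** * Transport along isomorphisms of complexes *)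

Lemma within_closure (X Y : topologicalType) (A S : set X) (f : X -> Y) x :
  {within A, continuous f} -> S `<=` A -> A x -> closure S x ->
  closure (f @` S) (f x).
Proof.
move=> /subspace_continuousP cf SA Ax cx V Vfx.
have [y [Sy Vy]] := cx _ (cf x Ax V Vfx).
by exists (f y); split; [exists y|exact: Vy (SA _ Sy)].
Qed.

Lemma within_comp (X Y Z : topologicalType) (A : set X) (B : set Y)
    (f : X -> Y) (g : Y -> Z) :
  {within A, continuous f} -> {within B, continuous g} ->
  (forall x, A x -> B (f x)) -> {within A, continuous (g \o f)}.
Proof.
move=> /subspace_continuousP cf /subspace_continuousP cg AB.
apply/subspace_continuousP => x Ax V Vx.
have nV := cf x Ax _ (cg _ (AB _ Ax) V Vx).
apply: (@filterS _ (nbhs x) _ _ _ _ nV) => y fy Ay; exact: (fy Ay (AB _ Ay)).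
Qed.

Section Iso.
Variables (C D : cell_complex) (h : space C -> space D) (phi : cell C -> cell D).
Hypothesis iso : complex_iso h phi.

Lemma iso_sub c : carrier C c `<=` @total C.
Proof. by move=> x cx; exists c. Qed.

(** The maps are continuous only within the unions of the cells. As these are closed, the closure of
    a cell does not leave them. *)
Lemma iso_closure c : closed (@total C) -> closed (@total D) ->
  h @` closure (carrier C c) = closure (carrier D (phi c)).
Proof.
move=> clC clD; have [[g [hg gh ch cg]] _ _ im] := iso.
have sub (E : cell_complex) (e : cell E) :
    closed (@total E) -> closure (carrier E e) `<=` @total E.
  by move=> /closure_id ->; apply: closureS => x ex; exists e.
apply/seteqP; split=> y.
  move=> [x cx <-]; rewrite -im.
  by apply: (within_closure ch) => //; [exact: iso_sub|exact: sub cx].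
move=> cy; have Dy := sub _ _ clD _ cy.
exists (g y); last by have [] := gh _ Dy.
have -> : carrier C c = g @` carrier D (phi c).
  rewrite -im; apply/seteqP; split=> x.
    by move=> cx; exists (h x); [exists x|have [] := hg _ (iso_sub cx)].
  by move=> [_ [z cz <-] <-]; have [_ ->] := hg _ (iso_sub cz).
by apply: (within_closure cg) => // z dz; exists (phi c).
Qed.

Lemma iso_inv_im c : exists2 g : space D -> space C,
  {within @total D, continuous g} & carrier C c = g @` carrier D (phi c).
Proof.
have [[g [hg gh ch cg]] _ _ im] := iso; exists g => //.
rewrite -im; apply/seteqP; split=> x.
  by move=> cx; exists (h x); [exists x|have [] := hg _ (iso_sub cx)].
by move=> [_ [z cz <-] <-]; have [_ ->] := hg _ (iso_sub cz).
Qed.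

Lemma iso_cubical (psi : cell D -> cubecell) : closed (@total C) -> closed (@total D) ->
  cubical psi -> cubical (psi \o phi).
Proof.
move=> clC clD H; have [[g [hg gh ch cg]] bij dims im] := iso.
have h_inj x y : @total C x -> @total C y -> h x = h y -> x = y.
  by move=> /hg[_ {2}<-] /hg[_ {2}<-] ->.
split.
- exact: bij_comp (cub_bij H) bij.
- by move=> c; rewrite /= -dims (cub_dim H).
- move=> b c _ _ [x [bx cx]]; apply: (bij_inj bij).
  by apply: (cub_meet H (x := h x)); rewrite -im; exists x.
- move=> c; have [g' cg' ->] := iso_inv_im c.
  apply: connected_continuous_connected; first exact: (cub_conn H).
  by apply: continuous_subspaceW cg' => x cx; exists (phi c).
- move=> c; have [y] := cub_ne H (phi c); rewrite -im => -[x cx _]; by exists x.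
- move=> c; apply/seteqP; split=> x.
    move=> cx; have hx : closure (carrier D (phi c)) (h x).
      by rewrite -iso_closure //; exists x.
    have [b' le] : (\bigcup_(b in [set b | le_cell (psi b) (psi (phi c))]) carrier D b) (h x).
      by rewrite -(cub_cl H).
    have [phi' phiK phi'K] := bij.
    rewrite -(phi'K b') -im => -[y yb] hyx; exists (phi' b'); first by rewrite /= phi'K.
    suff -> : x = y by [].
    apply: h_inj => //; last by exists (phi' b').
    move/closure_id: clC => ->; apply: closureS cx; exact: iso_sub.
  move=> [b /= le bx].
  have : closure (carrier D (phi c)) (h x).
    by rewrite (cub_cl H); exists (phi b) => //; rewrite -im; exists x.
  rewrite -iso_closure // => -[y cy hyx].
  suff -> : x = y by [].
  apply: h_inj => //; first by exists b.
  move/closure_id: clC => ->; apply: closureS cy; exact: iso_sub.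
Qed.
End Iso.

Lemma complex_iso_comp (C D E : cell_complex) h phi h' phi' :
  @complex_iso C D h phi -> @complex_iso D E h' phi' ->
  complex_iso (h' \o h) (phi' \o phi).
Proof.
move=> [[g [hg gh ch cg]] bij dims im] [[g' [hg' gh' ch' cg']] bij' dims' im'].
split.
- exists (g \o g'); split.
  + move=> x Cx; have [Dhx ghx] := hg _ Cx; have [Eh g'h] := hg' _ Dhx.
    by split=> //=; rewrite g'h.
  + move=> y Ey; have [Dy hy] := gh' _ Ey; have [Cy hy'] := gh _ Dy.
    by split=> //=; rewrite hy'.
  + by apply: within_comp ch ch' _ => x /hg[].
  + by apply: within_comp cg' cg _ => x /gh'[].
- exact: bij_comp.
- by move=> c; rewrite /= dims' dims.
- by move=> c; rewrite -image_comp im im'.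
Qed.

(** * Linear symmetries of the solid cube *)

Section CubeSymmetry.
Variables (R : realType).
Let Q := solid_cube R.

Definition symm_map (g : symm) (x : 'rV[R]_3) : 'rV[R]_3 :=
  \row_i ((-1) ^+ (nth false (sflip g) i : bool) * x 0 (inord (nth 0%N (sperm g) i))).

Definition symm_cell (g : symm) (s : cell Q) : cell Q := of_triple (act_cell g (to_triple s)).

Lemma symm_map_continuous g : continuous (symm_map g).
Proof.
apply: rV_continuous => i; rewrite /symm_map; under eq_fun do rewrite mxE.
move=> x; exact: (continuousM (@cst_continuous _ _ _ x) (@coord_continuous R 1 3 0 _ x)).
Qed.

Lemma symm_crdP g (i : 'I_3) : g \in symms ->
  [/\ nth 0%N (sperm g) i < 3, nth 0%N (sperm (symm_inv g)) i < 3,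
       nth 0%N (sperm g) (nth 0%N (sperm (symm_inv g)) i) = i,
       nth 0%N (sperm (symm_inv g)) (nth 0%N (sperm g) i) = i &
       nth false (sflip (symm_inv g)) i =
         nth false (sflip g) (nth 0%N (sperm (symm_inv g)) i) /\
       nth false (sflip (symm_inv g)) (nth 0%N (sperm g) i) = nth false (sflip g) i]%N.
Proof.
move=> gs; have mi : (i : nat) \in iota 0 3 by rewrite mem_iota /=.
have /allP/(_ _ mi) := allP symms_crd_ok _ gs.
by move=> /and5P[? ? /eqP ? /eqP ? /andP[/eqP ? /eqP ?]].
Qed.

Lemma symm_mapK g : g \in symms -> cancel (symm_map g) (symm_map (symm_inv g)).
Proof.
move=> gs x; apply/rowP => i; have [p1 p2 e1 e2 [e3 e4]] := symm_crdP i gs.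
rewrite !mxE !inordK // e1 e3 mulrA -expr2 sqrr_sign mul1r.
by congr (x _ _); apply: val_inj; rewrite /= inordK.
Qed.

Lemma symm_mapKV g : g \in symms -> cancel (symm_map (symm_inv g)) (symm_map g).
Proof.
move=> gs x; apply/rowP => i; have [p1 p2 e1 e2 [e3 e4]] := symm_crdP i gs.
rewrite !mxE !inordK // e2 e4 mulrA -expr2 sqrr_sign mul1r.
by congr (x _ _); apply: val_inj; rewrite /= inordK.
Qed.

Lemma in1_flip (b : bool) a (t : R) : in1 a t ->
  in1 (if b then omap negb a else a) ((-1) ^+ b * t).
Proof.
case: b; rewrite /= ?expr0 ?expr1 ?mul1r // mulN1r.
by case: a => [[]|]; rewrite /in1 /= /sgb; lra.
Qed.

Lemma crd_act_cell g c (i : 'I_3) : crd (act_cell g c) i =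
  (if nth false (sflip g) i then omap negb (crd c (nth 0%N (sperm g) i))
   else crd c (nth 0%N (sperm g) i)).
Proof. by case: i => [[|[|[|//]]] lt]. Qed.

Lemma symm_map_carrier g s x : g \in symms ->
  carrier Q s x -> carrier Q (symm_cell g s) (symm_map g x).
Proof.
move=> gs /carrierP h; apply/carrierP => i; have [p1 p2 e1 e2 _] := symm_crdP i gs.
rewrite mxE /symm_cell ffunE crd_act_cell; apply: in1_flip.
have -> : crd (to_triple s) (nth 0%N (sperm g) i) = s (inord (nth 0%N (sperm g) i)).
  by rewrite -crd_to_triple inordK.
exact: h.
Qed.

Lemma symm_inv_symm g : g \in symms -> symm_inv g \in symms.
Proof.
have : all (fun g => symm_inv g \in symms) symms by vm_compute.
by move=> /allP; apply.
Qed.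

Lemma symm_cellK g : g \in symms -> cancel (symm_cell g) (symm_cell (symm_inv g)).
Proof. by move=> gs s; rewrite /symm_cell of_tripleK act_cellK // to_tripleK. Qed.

Lemma symm_cellKV g : g \in symms -> cancel (symm_cell (symm_inv g)) (symm_cell g).
Proof. by move=> gs s; rewrite /symm_cell of_tripleK act_cellKV // to_tripleK. Qed.

Lemma symm_iso g : g \in symms -> @complex_iso Q Q (symm_map g) (symm_cell g).
Proof.
move=> gs; have gs' := symm_inv_symm gs; split.
- exists (symm_map (symm_inv g)); split.
  + move=> x [s _ sx]; split; last exact: symm_mapK.
    by exists (symm_cell g s) => //; exact: symm_map_carrier.
  + move=> x [s _ sx]; split; last exact: symm_mapKV.
    by exists (symm_cell (symm_inv g) s) => //; exact: symm_map_carrier.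
  + by apply: continuous_subspaceT => x; exact: symm_map_continuous.
  + by apply: continuous_subspaceT => x; exact: symm_map_continuous.
- by exists (symm_cell (symm_inv g)); [exact: symm_cellK|exact: symm_cellKV].
- by move=> s; rewrite !(cub_dim (cube_cubical R)) /symm_cell of_tripleK dim_act_cell.
- move=> s; apply/seteqP; split=> y.
    by move=> [x sx <-]; exact: symm_map_carrier.
  move=> sy; exists (symm_map (symm_inv g) y); last exact: symm_mapKV.
  by rewrite -(symm_cellK gs s); exact: symm_map_carrier.
Qed.

Lemma cube_total_closed : closed (@total Q).
Proof.
have -> : @total Q = closure (carrier Q (of_triple (None, None, None))).
  rewrite (cub_cl (cube_cubical R)) /total; congr (\bigcup_(_ in _) _).
  apply/seteqP; split=> s //= _; rewrite of_tripleK /le_cell.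
  by case: (to_triple s) => [[? ?] ?].
exact: closed_closure.
Qed.
End CubeSymmetry.

Local Close Scope ring_scope.

(** * The code of a template *)

Lemma eq_cellE a b : eq_cell a b = (a == b).
Proof. by apply/eq_cellP/eqP. Qed.

Lemma lo_hi e : e \in edges ->
  [/\ le_cell (lo_end e) e && (lo_end e != e),
    le_cell (hi_end e) e && (hi_end e != e) & lo_end e != hi_end e].
Proof. by move: e => [[[[]|] [[]|]] [[]|]]. Qed.

Lemma lo_corner e : e \in edges -> le_cell corner e -> lo_end e = corner.
Proof. by move: e => [[[[]|] [[]|]] [[]|]]. Qed.

Lemma face_above c : dim_cell c < 3 -> exists2 f, f \in faces & le_cell c f.
Proof.
move=> c3; have : all (fun c => (dim_cell c < 3) ==> has (le_cell c) faces) cells by vm_compute.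
by move=> /allP/(_ _ (mem_cells c))/implyP/(_ c3)/hasP.
Qed.

Lemma le_cell_dim c d : le_cell c d -> dim_cell c <= dim_cell d.
Proof.
by move=> le; have [->//|ne] := eqVneq c d; exact: ltnW (dim_cell_lt le ne).
Qed.

Section Extract.
Variables (R : realType) (U : template_data) (phi : cell U -> cubecell).
Hypothesis H : cubical phi.
Hypothesis tpl : is_3cell_template R U.
Hypothesis phi_north : phi (north U) = corner.

Let psi (k : cubecell) : cell U := projT1 (cid (cub_surj H k)).
Let psiK k : phi (psi k) = k.
Proof. by rewrite /psi; case: cid. Qed.
Let phiK c : psi (phi c) = c.
Proof. by apply: (cub_inj H); rewrite psiK. Qed.

Let cup (P : set (cell U)) : set (space U) := \bigcup_(c in P) carrier U c.
Let insup c := in_support (map phi (merWE U)) (phi c) ||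
  in_support (map phi (merEW U)) (phi c).
Let Acells : set (cell U) := [set c | dim_cell (phi c) < 3 /\ ~~ insup c].
Let A := cup Acells.

(** The cell [B] of dimension 3 is the only one with all coordinates free, and all other cells make
    up its boundary. The complement of the meridians is therefore the union [A] of cells. *)
Let tplE : [/\ bipolar U,
  dipath (north U) (merWE U) (south U) /\ dipath (north U) (merEW U) (south U),
   support (merWE U) `&` support (merEW U) =
     carrier U (north U) `|` carrier U (south U),
   hemiW U <> hemiE U /\ components A = [set hemiW U; hemiE U] &
   (forall e v : cell U, dim U e = 1 -> meridian_vertex v ->
        carrier U v `<=` bd e ->
        (carrier U e `<=` hemiW U -> ehead U e = v) /\
        (carrier U e `<=` hemiE U -> etail U e = v)) /\
   (overlap (merWE U) /\ overlap (merEW U))].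
Proof.
have [_ [B [[dB _] [bip p1 p2 meet] [neq comp] loc ov]]] := tpl.
split=> //; split=> //; rewrite -comp; congr components.
rewrite (bdE H) !(supportE _ H) cupU (cupD H); congr cup; apply/seteqP.
have topP k : dim_cell k = 3 -> k = (None, None, None).
  by case: k => [[[[]|] [[]|]] [[]|]].
have Btop : phi B = (None, None, None) by apply: topP; rewrite -(cub_dim H).
have dO (c : cell U) : dim_cell (phi c) < 3 <-> c <> B.
  split=> [lt cO|nO]; first by move: lt; rewrite cO Btop.
  have : phi c <> (None, None, None) by move=> cO; apply: nO; apply: (cub_inj H); rewrite cO.
  by case: (phi c) => [[[[]|] [[]|]] [[]|]].
have leB c : le_cell (phi c) (phi B) by rewrite Btop /le_cell; case: (phi c) => [[? ?] ?].
split=> c /=; rewrite /insup.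
  by move=> [/dO lt /negP ns]; split; [split|move=> /orP].
by move=> [[_ /dO lt] ns]; split=> //; apply/negP => /orP.
Qed.

Let edgeP e : e \in edges -> dim U (psi e) = 1.
Proof. by rewrite mem_edges (cub_dim H) psiK => /eqP. Qed.

Let o : seq bool := [seq phi (etail U (psi e)) == lo_end e | e <- edges].
Let w : seq bool := [seq `[< carrier U (psi f) `<=` hemiW U >] | f <- faces].
Let p := map phi (merWE U).
Let q := map phi (merEW U).
Let S := phi (south U).
Let d := mk_code o S p q w.

(** The boundary of an edge consists of its tail and head on one side and contains its two distinct
    ends in the cube on the other, so these agree up to the order recorded in [o]. *)
Let ends e : e \in edges ->
  tail_of o e = phi (etail U (psi e)) /\ head_of o e = phi (ehead U (psi e)).
Proof.
move=> ee; have [[ori _ _ _] _ _ _ _] := tplE.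
have [t0 h0 th bdU] := ori _ (edgeP ee).
have inb c : le_cell (phi c) e && (phi c != e) -> c = etail U (psi e) \/ c = ehead U (psi e).
  move=> /andP[le ne]; have : carrier U c `<=` bd (psi e).
    by apply/(sub_bd H); rewrite psiK; split=> // ce; move: ne; rewrite ce psiK eqxx.
  rewrite bdU [carrier U (etail _ _)]carrier_cup [carrier U (ehead _ _)]carrier_cup.
  by rewrite cupU (sub_cup H).
have [lle hle lh] := lo_hi ee.
have {}lle : psi (lo_end e) = etail U (psi e) \/ psi (lo_end e) = ehead U (psi e).
  by apply: inb; rewrite psiK.
have {}hle : psi (hi_end e) = etail U (psi e) \/ psi (hi_end e) = ehead U (psi e).
  by apply: inb; rewrite psiK.
rewrite /tail_of /head_of lookup_map //.
have nlh : psi (lo_end e) <> psi (hi_end e) by move=> /(congr1 phi); rewrite !psiK; apply/eqP.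
case: eqP => [tlo|ntlo].
  rewrite tlo; split=> //; case: hle => [he|<-]; last by rewrite psiK.
  by case: nlh; rewrite he -tlo phiK.
case: lle => [le|le]; first by case: ntlo; rewrite -le psiK.
rewrite -le psiK; split=> //; case: hle => [<-|he]; first by rewrite psiK.
by case: nlh; rewrite le he.
Qed.

Let disj_hemis x : hemiW U x -> hemiE U x -> False.
Proof.
move=> Wx Ex; have [_ _ _ [ne comp] _] := tplE; apply: ne.
have [y Ay Wy] : components A (hemiW U) by rewrite comp; left.
have [z Az Ez] : components A (hemiE U) by rewrite comp; right.
rewrite -Wy -Ez; rewrite -Wy in Wx; rewrite -Ez in Ex.
by rewrite (same_connected_component Wx) (same_connected_component Ex).
Qed.

Let cover_hemis x : A x -> hemiW U x \/ hemiE U x.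
Proof.
move=> Ax; have [_ _ _ [ne comp] _] := tplE.
have : [set hemiW U; hemiE U] (connected_component A x) by rewrite -comp; exists x.
by case=> <-; [left|right]; exact: connected_component_refl.
Qed.

Let hemis_sub : hemiW U `<=` A /\ hemiE U `<=` A.
Proof.
have [_ _ _ [ne comp] _] := tplE.
have [y Ay <-] : components A (hemiW U) by rewrite comp; left.
have [z Az <-] : components A (hemiE U) by rewrite comp; right.
by split; exact: connected_component_sub.
Qed.

Let hemis_ne : hemiW U !=set0 /\ hemiE U !=set0.
Proof.
have [_ _ _ [ne comp] _] := tplE.
have [y Ay <-] : components A (hemiW U) by rewrite comp; left.
have [z Az <-] : components A (hemiE U) by rewrite comp; right.
by split; [exists y|exists z]; exact: connected_component_refl.
Qed.

Let connected_side (B : set (space U)) x : connected B -> B `<=` A -> B x ->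
  (hemiW U x -> B `<=` hemiW U) /\ (hemiE U x -> B `<=` hemiE U).
Proof.
move=> cB BA Bx; have [_ _ _ [ne comp] _] := tplE.
have [y Ay <-] : components A (hemiW U) by rewrite comp; left.
have [z Az <-] : components A (hemiE U) by rewrite comp; right.
by split=> /same_connected_component ->; exact: connected_component_max.
Qed.

Let AcellP c : Acells c -> carrier U c `<=` A.
Proof. by move=> Ac x cx; exists c. Qed.

Let side c : Acells c -> carrier U c `<=` hemiW U \/ carrier U c `<=` hemiE U.
Proof.
move=> Ac; have [x cx] := cub_ne H c.
have [sW sE] := connected_side (cub_conn H c) (AcellP Ac) cx.
by case: (cover_hemis (AcellP Ac cx)) => [/sW|/sE]; [left|right].
Qed.

Let sideE c : Acells c -> carrier U c `<=` hemiE U <-> ~ carrier U c `<=` hemiW U.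
Proof.
move=> Ac; split=> [cE cW|nW]; last by case: (side Ac).
by have [x cx] := cub_ne H c; exact: (disj_hemis (cW _ cx) (cE _ cx)).
Qed.

Let side_adj b c : Acells b -> Acells c -> le_cell (phi b) (phi c) ->
  (carrier U b `<=` hemiW U <-> carrier U c `<=` hemiW U).
Proof.
move=> Ab Ac le; have con := adj_connected H le.
have sub : carrier U b `|` carrier U c `<=` A.
  by move=> x [] h; [exact: AcellP Ab _ h|exact: AcellP Ac _ h].
have [x bx] := cub_ne H b; have [y cy] := cub_ne H c.
split=> hW z hz.
  by apply: (connected_side con sub (or_introl bx)).1 => //; [exact: hW|right].
by apply: (connected_side con sub (or_intror cy)).1 => //; [exact: hW|left].
Qed.

(** The supports of the meridians are closed under passing to smaller cells. *)
Let Acell_up b c : dim_cell (phi c) < 3 -> le_cell (phi b) (phi c) -> Acells b -> Acells c.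
Proof.
move=> c3 le [_ ns]; split=> //; apply: contra ns.
rewrite /insup /in_support !hasbE => /orP[] /hasP[e ep h]; apply/orP; [left|right];
  by apply/hasP; exists e => //; exact: le_cell_trans le h.
Qed.

Let lookup_face f : f \in faces ->
  lookup faces w f = `[< carrier U (psi f) `<=` hemiW U >].
Proof. by move=> ff; rewrite /w (lookup_map (fun f => `[< carrier U (psi f) `<=` hemiW U >])). Qed.

Let face_lt3 f : f \in faces -> dim_cell (phi (psi f)) < 3.
Proof. by rewrite psiK mem_faces => /eqP ->. Qed.

Let hemiP (v : cubecell -> bool) c : hemi p q v (phi c) <->
  Acells c /\ exists2 f, f \in faces & le_cell (phi c) f /\ v f.
Proof.
have hE : hemi p q v (phi c) = ~~ insup c && has (fun f => le_cell (phi c) f && v f) faces.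
  by rewrite /hemi /insup -/p -/q hasbE; case: (in_support p _); case: (in_support q _).
rewrite hE; split.
  move=> /andP[ns /hasP[f ff /andP[le vf]]]; split; last by exists f.
  split=> //; apply: leq_ltn_trans (le_cell_dim le) _.
  by rewrite mem_faces in ff; rewrite (eqP ff).
by move=> [[_ ->] [f ff [le vf]]]; rewrite andTb; apply/hasP; exists f; rewrite ?le.
Qed.

(** Every cell of [A] has a face above it; this face is in [A] too and lies on the same side by
    [side_adj], so the colours of the faces decide. *)
Let in_hemiW : hemiW U = cup [set c | cW d (phi c)].
Proof.
apply/seteqP; split=> x.
  move=> Wx; have [c Ac cx] := hemis_sub.1 _ Wx; exists c => //=; apply/hemiP; split=> //.
  have [f ff le] := face_above Ac.1; exists f => //; split=> //.
  apply: (etrans (lookup_face ff)); apply/asboolP.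
  have Af : Acells (psi f) by apply: Acell_up Ac; rewrite ?face_lt3 ?psiK.
  apply/(side_adj Ac Af); first by rewrite psiK.
  exact: (connected_side (cub_conn H c) (AcellP Ac) cx).1.
move=> [c /= /hemiP[Ac [f ff [le vf]]] cx].
have /asboolP fW := etrans (esym (lookup_face ff)) vf.
have Af : Acells (psi f) by apply: Acell_up Ac; rewrite ?face_lt3 ?psiK.
by have /(side_adj Ac Af) := fW; apply => //; rewrite psiK.
Qed.

Let in_hemiE : hemiE U = cup [set c | cE d (phi c)].
Proof.
apply/seteqP; split=> x.
  move=> Ex; have [c Ac cx] := hemis_sub.2 _ Ex; exists c => //=; apply/hemiP; split=> //.
  have [f ff le] := face_above Ac.1; exists f => //; split=> //.
  apply: (etrans (congr1 negb (lookup_face ff))); apply/asboolPn.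
  have Af : Acells (psi f) by apply: Acell_up Ac; rewrite ?face_lt3 ?psiK.
  move=> /(side_adj Ac Af) cW; apply: (@disj_hemis x) => //; apply: cW => //.
  by rewrite psiK.
move=> [c /= /hemiP[Ac [f ff [le vf]]] cx].
have /asboolPn fW := etrans (esym (congr1 negb (lookup_face ff))) vf.
have Af : Acells (psi f) by apply: Acell_up Ac; rewrite ?face_lt3 ?psiK.
have /(sideE Ac) : ~ carrier U c `<=` hemiW U.
  by move=> /(side_adj Ac Af) h; apply: fW; apply: h; rewrite psiK.
exact.
Qed.

Let D : encodes phi d.
Proof.
split=> //; try (by [exact: in_hemiW|exact: in_hemiE]).
- move=> e de; have ee : phi e \in edges by rewrite mem_edges -(cub_dim H) de.
  by apply: (etrans _ (esym (ends ee).1)); rewrite phiK.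
- move=> e de; have ee : phi e \in edges by rewrite mem_edges -(cub_dim H) de.
  by apply: (etrans _ (esym (ends ee).2)); rewrite phiK.
Qed.

Let arcE u v : arc u v = in_arc o (phi u) (phi v).
Proof.
rewrite (arc_codes H D) /in_arc hasbE; apply: eq_has => e /=.
by rewrite !eq_cellE; case: (_ == phi u).
Qed.

Let acyclic : forall s : seq (cell U), cycle (@arc U) s -> s = [::].
Proof. by have [[]] := tplE. Qed.

Let no_arc_north u : ~~ arc u (north U).
Proof. by have [[_ _ /(_ (north U)) [_ /(_ erefl)] [_ h]] _ _ _ _ _] := tplE; exact: h. Qed.

Let no_arc_south u : ~~ arc (south U) u.
Proof. by have [[_ _ _ /(_ (south U)) [_ /(_ erefl)] [_ h]] _ _ _ _] := tplE; exact: h. Qed.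

(** An edge at [corner] with the opposite bit would end in the North pole, which is a source. *)
Let orients_o : o \in orients.
Proof.
apply: (mem_orients (b := fun e => phi (etail U (psi e)) == lo_end e)) => e ee le.
have [te he] := ends ee; rewrite -te /tail_of; move: he; rewrite /head_of; case: ifP => // _ he.
have := no_arc_north (etail U (psi e)); suff -> : arc (etail U (psi e)) (north U) by [].
apply/existsP; exists (psi e); rewrite edgeP // !eqxx /=.
by apply/eqP/(cub_inj H); rewrite -he lo_corner.
Qed.

Let vertexS : S \in vertices.
Proof.
have [[_ _ _ /(_ (south U)) [_ /(_ erefl)] [dS _]] _ _ _ _] := tplE.
by rewrite mem_vertices -(cub_dim H) dS.
Qed.

Let source_o : source_only o.
Proof.
rewrite /source_only allbE; apply/allP => v vv; case: eq_cellP => // vN.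
rewrite hasbE; apply: contrapT => /negP/hasPn nh; apply: vN.
have [[_ _ src _] _ _ _ _] := tplE; rewrite -phi_north -(psiK v); congr phi; apply/src.
split=> [|u]; first by apply/eqP; rewrite (cub_dim H) psiK -mem_vertices.
rewrite arcE psiK /in_arc hasbE; apply/hasPn => e /nh.
by case: eq_cellP => // _; case: ifP.
Qed.

Let sink_o : sink_only o S.
Proof.
rewrite /sink_only hasbE; case: ifP => [/hasP[e ee /eq_cellP te]|_].
  have := no_arc_south (psi (head_of o e)).
  rewrite arcE psiK /in_arc hasbE => /hasPn/(_ _ ee).
  by rewrite te !eq_cellE !eqxx.
rewrite allbE; apply/allP => v vv; case: eq_cellP => // vS.
rewrite hasbE; apply: contrapT => /negP/hasPn nh; apply: vS.
have [[_ _ _ snk] _ _ _ _] := tplE; rewrite /S -(psiK v); congr phi; apply/snk.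
split=> [|u]; first by apply/eqP; rewrite (cub_dim H) psiK -mem_vertices.
rewrite arcE psiK /in_arc hasbE; apply/hasPn => e /nh.
by case: eq_cellP.
Qed.

Let orient_o : orient_ok o.
Proof.
rewrite /orient_ok source_o hasbE; case: ifP => // /hasP[s sF].
rewrite is_dicycleE ?face_cycles_neq0 // => cyc.
have := face_cycles_neq0 sF; have : map psi s = [::].
  apply: acyclic; rewrite cycle_map; apply: sub_cycle cyc => x y.
  by rewrite /= arcE !psiK.
by case: (s).
Qed.

Let meridian_path m : dipath (north U) m (south U) ->
  map phi m \in paths (tail_of o) (head_of o) 7 corner S.
Proof.
move=> dm; apply: paths_complete.
- by rewrite -phi_north; rewrite (dipath_codes H D) in dm.
- rewrite size_map.
  have walk u m' v : dipath u m' v -> path (@arc U) u (map (ehead U) m').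
    elim: m' u => //= e m' IH u /and3P[de te /IH ->]; rewrite andbT.
    by apply/existsP; exists e; rewrite de te eqxx.
  have uniq_path x s : path (@arc U) x s -> uniq (x :: s).
    elim: s x => [//|y s IH] x xs; rewrite cons_uniq; apply/andP; split; last first.
      by case/andP: xs => _ /IH.
    (* A second visit to [x] would close the walk up to that point into a directed cycle. *)
    apply/negP => xin; move: xs; case/path.splitP: xin => s1 s2; rewrite cat_path => /andP[c _].
    by have := acyclic (s := x :: s1) c.
  have um := uniq_path _ _ (walk _ _ _ dm).
  have vert u m' v : dim U u = 0 -> dipath u m' v ->
      all (fun c => dim U c == 0) (u :: map (ehead U) m').
    have [[ori _ _ _] _ _ _ _] := tplE.
    elim: m' u => [|e m' IH] u du /=; first by rewrite du.
    move=> /and3P[/eqP de _ dp]; rewrite du eqxx /=; apply: IH dp.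
    by have [] := ori _ de.
  have dN : dim U (north U) = 0 by rewrite (cub_dim H) phi_north.
  have vm := vert _ _ _ dN dm.
  have : size (map phi (north U :: map (ehead U) m)) <= size vertices.
    apply: uniq_leq_size; first by rewrite map_inj_uniq //; exact: (cub_inj H).
    move=> k /mapP[c cm ->]; rewrite mem_vertices -(cub_dim H); exact: (allP vm).
  by rewrite size_map /= size_map.
move=> e ee; apply/negP => /eqP te.
have := no_arc_south (psi (head_of o e)); rewrite arcE psiK /in_arc hasbE => /hasPn/(_ _ ee).
by rewrite te !eq_cellE !eqxx.
Qed.

Let meet_o : meet_ok S p q.
Proof.
have [_ _ meet _ _] := tplE.
rewrite /meet_ok allbE; apply/allP => k _; case: ifP => // kp; case: ifP => // kq.
have : (support (merWE U) `&` support (merEW U)) `<=`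
    carrier U (north U) `|` carrier U (south U) by rewrite meet.
rewrite !(supportE _ H) (cupI H) [carrier U (north U)]carrier_cup.
rewrite [carrier U (south U)]carrier_cup cupU => sub.
have [x kx] := cub_ne H (psi k).
have [c Pc cx] := sub x (ex_intro2 _ _ (psi k)
  (conj (etrans (congr1 _ (psiK k)) kp) (etrans (congr1 _ (psiK k)) kq)) kx).
have := cub_meet H kx cx => kc; rewrite -(psiK k) kc.
case: Pc => ->; first by rewrite phi_north; case: eq_cellP.
by case: eq_cellP => // _; rewrite /S; case: eq_cellP.
Qed.

Let color_o : color_ok p q (lookup faces w).
Proof.
have [[x Wx] [y Ey]] := hemis_ne.
rewrite /color_ok !hasbE.
have -> : has (lookup faces w) faces.
  move: Wx; rewrite in_hemiW => -[c /hemiP[_ [f ff [_ wf]]] _].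
  by apply/hasP; exists f.
have -> : has (fun f => ~~ lookup faces w f) faces.
  move: Ey; rewrite in_hemiE => -[c /hemiP[_ [f ff [_ wf]]] _].
  by apply/hasP; exists f.
rewrite allbE; apply/allP => e ee; case: ifP => // pe; case: ifP => // qe.
have Ae : Acells (psi e).
  split; first by move: ee; rewrite psiK mem_edges => /eqP ->.
  by rewrite /insup psiK -/p -/q pe qe.
rewrite allbE; apply/allP => f; rewrite mem_filter => /andP[lef ff].
rewrite allbE; apply/allP => f'; rewrite mem_filter => /andP[lef' ff'].
have Af : Acells (psi f) by apply: Acell_up Ae; rewrite ?face_lt3 ?psiK.
have Af' : Acells (psi f') by apply: Acell_up Ae; rewrite ?face_lt3 ?psiK.
have h1 : carrier U (psi e) `<=` hemiW U <-> carrier U (psi f) `<=` hemiW U.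
  by apply: side_adj => //; rewrite !psiK.
have h2 : carrier U (psi e) `<=` hemiW U <-> carrier U (psi f') `<=` hemiW U.
  by apply: side_adj => //; rewrite !psiK.
rewrite !lookup_face //.
have -> : `[< carrier U (psi f) `<=` hemiW U >] = `[< carrier U (psi f') `<=` hemiW U >].
  by apply/asboolP/asboolP => h; [apply/h2/h1|apply/h1/h2].
by case: `[< _ >].
Qed.

Let local_o : local_ok d.
Proof.
have [[ori _ _ _] _ _ _ [loc _]] := tplE.
rewrite /local_ok allbE; apply/allP => v vv; case: eq_cellP => // vN; case: eq_cellP => // vS.
case: ifP => // vsup; rewrite allbE; apply/allP => e ee; case: ifP => // le.
have mv : meridian_vertex (psi v).
  split.
  - by move: vv; rewrite mem_vertices (cub_dim H) psiK => /eqP.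
  - by move=> vE; apply: vN; rewrite -[cnorth d]/corner -phi_north -vE psiK.
  - by move=> vE; apply: vS; rewrite -[csouth d]/(phi (south U)) -vE psiK.
  - by apply/(in_support_codes H D); rewrite psiK; move: vsup; case: (in_support _ v).
have vbd : carrier U (psi v) `<=` bd (psi e).
  apply/(sub_bd H); rewrite !psiK; split=> // /(congr1 phi); rewrite !psiK => ve.
  by move: vv ee; rewrite mem_vertices mem_edges ve => /eqP ->.
have [lW lE] := loc _ _ (edgeP ee) mv vbd.
case: ifP => [We|_].
  apply/eq_cellP; apply: (etrans (ends ee).2); rewrite lW ?psiK //.
  by apply/(hemiW_codes H D); rewrite psiK.
case: ifP => // Ee.
apply/eq_cellP; apply: (etrans (ends ee).1); rewrite lE ?psiK //.
by apply/(hemiE_codes H D); rewrite psiK.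
Qed.

Let overlap_o m : overlap m -> overlap_ok d (map phi m).
Proof.
move=> [e0 [e1 [f [g [h0 h1 [[df fW bf] _] [[dg gE bg] _] [e em sub]]]]]].
case: m h0 h1 em => [//|x m] [xe]; rewrite {1}lastI rev_rcons => -[le] em; subst e0 e1.
have fF : phi f \in faces by rewrite mem_faces -(cub_dim H) df.
have gF : phi g \in faces by rewrite mem_faces -(cub_dim H) dg.
rewrite map_cons; apply/overlap_okP; exists (phi f), (phi g), (phi e).
have eb1 : carrier U e `<=` bd f by move=> z /sub[].
have eb2 : carrier U e `<=` bd g by move=> z /sub[].
split=> //.
- by rewrite -map_cons; apply: map_f.
- split; first exact/(hemiW_codes H D).
    by move/(sub_bd H): bf => [].
  by move/(sub_bd H): eb1 => [].
- split; first exact/(hemiE_codes H D).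
    by rewrite last_map; move/(sub_bd H): bg => [].
  by move/(sub_bd H): eb2 => [].
Qed.

Lemma template_code : exists2 d', encodes phi d' & has (equiv_code d') reps.
Proof.
have [_ [p1 p2] _ _ [_ [ov1 ov2]]] := tplE.
exists d; first exact: D.
apply: classifiedP orients_o orient_o vertexS sink_o (meridian_path p1)
  (meridian_path p2) meet_o _ color_o _; first by apply: mem_bitseqs; rewrite size_map.
rewrite /code_ok local_o.
have -> : overlap_ok d (cWE d) by apply: overlap_o.
by apply: overlap_o.
Qed.

End Extract.

(** * Equality and equivalence of codes *)

Lemma eq_cellsP p q : reflect (p = q) (eq_cells p q).
Proof.
elim: p q => [|x p IH] [|y q] /=; try by constructor.
case: eq_cellP => [->|ne]; last by constructor => -[].
by apply: (iffP (IH q)) => [->|[]].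
Qed.

Lemma eq_codeP d d' : eq_code d d' <->
  [/\ cnorth d = cnorth d' /\ csouth d = csouth d',
      cWE d = cWE d' /\ cEW d = cEW d',
      forall e, e \in edges -> ctail d e = ctail d' e /\ chead d e = chead d' e &
      forall c, cW d c = cW d' c /\ cE d c = cE d' c].
Proof.
rewrite /eq_code !allbE; split.
  case: eq_cellP => // eS; case: eq_cellsP => // e1; case: eq_cellsP => // e2; case: eq_cellP => // eN.
  case: ifP => // /allP ht; case: ifP => // /allP hW /allP hE; split=> //.
    by move=> e /ht; case: eq_cellP => // -> /eq_cellP.
  by move=> c; rewrite -(eqP (hW _ (mem_cells c))) -(eqP (hE _ (mem_cells c))).
move=> [[eN eS] [e1 e2] ht hc].
case: eq_cellP => // _; case: eq_cellsP => // _; case: eq_cellsP => // _; case: eq_cellP => // _.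
have -> : all (fun e => if eq_cell (ctail d e) (ctail d' e)
                    then eq_cell (chead d e) (chead d' e) else false) edges.
  by apply/allP => e /ht[-> ->]; rewrite !eq_cellE !eqxx.
have -> : all (fun c => eqb (cW d c) (cW d' c)) cells.
  by apply/allP => c _; have [-> _] := hc c; case: (cW d' c).
by apply/allP => c _; have [_ ->] := hc c; case: (cE d' c).
Qed.

(** Codes have functions as fields and thus no boolean equality for [\in], whence [List.In]. In the
    proof [P] is made abstract, so that simplification does not run the search over the
    symmetries. *)
Lemma equiv_codeP d d' :
  equiv_code d d' <-> exists2 k, List.In k (kleins d) &
    exists2 g, g \in symms & eq_code (act_code g k) d'.
Proof.
rewrite /equiv_code; set P := fun k => hasb _ symms.
have PP k : P k <-> exists2 g, g \in symms & eq_code (act_code g k) d'.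
  by rewrite /P hasbE; split=> [/hasP|[g gs gd]] //; apply/hasP; exists g.
move: P PP => P PP; split; last first.
  by move=> [k kd /PP Pk]; move: kd Pk => /= [->|[->|[->|[->|[]]]]] ->; do ?case: ifP.
rewrite /kleins /=.
case: ifP => [/PP ? _|_]; first by exists d; [left|].
case: ifP => [/PP ? _|_]; first by exists (kappa_code d); [right; left|].
case: ifP => [/PP ? _|_]; first by exists (rho_code d); [right; right; left|].
by case: ifP => [/PP ? _|_] //; exists (kappa_code (rho_code d)); [do 3!right; left|].
Qed.

(** * The seven templates *)

Section Realization.
Variable R : realType.
Let Q := solid_cube R.

Definition realize (d : code) : template_data := @TemplateData Q
  (fun e => of_triple (ctail d (to_triple e))) (fun e => of_triple (chead d (to_triple e)))
  (of_triple (cnorth d)) (of_triple (csouth d)) (map of_triple (cWE d)) (map of_triple (cEW d))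
  (\bigcup_(c in [set c | cW d (to_triple c)]) carrier Q c)
  (\bigcup_(c in [set c | cE d (to_triple c)]) carrier Q c).

Lemma realize_codes d : @encodes (realize d) to_triple d.
Proof.
by split=> //= *; rewrite ?of_tripleK // mapK //; exact: of_tripleK.
Qed.

Lemma codes_kappa (U : template_data) phi d :
  @encodes U phi d -> @encodes (kappa U) phi (kappa_code d).
Proof. by case=> *; split=> //=; rewrite map_rev; congr rev. Qed.

Lemma codes_rho (U : template_data) phi d :
  @encodes U phi d -> @encodes (rho U) phi (rho_code d).
Proof. by case=> *; split. Qed.

Lemma codes_template_iso (U : template_data) (h : space U -> space Q) phi d d' g :
  @complex_iso U Q h phi -> encodes (to_triple \o phi) d ->
  g \in symms -> eq_code (act_code g d) d' -> template_iso U (realize d').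
Proof.
move=> iso cd gs /eq_codeP[[eN eS] [e1 e2] ht hc].
have giso := symm_iso R gs.
have [hom bij dims im] := complex_iso_comp iso giso.
exists (symm_map g \o h), (symm_cell g \o phi).
have symm_cellE c : to_triple (symm_cell g (phi c)) = act_cell g (to_triple (phi c)).
  by rewrite /symm_cell of_tripleK.
have edge_act e : dim U e = 1 -> act_cell g (to_triple (phi e)) \in edges.
  by move=> de; rewrite mem_edges dim_act_cell // -(cub_dim (cube_cubical R)) -de;
     have [_ _ -> _] := iso.
split.
- by split.
- move=> e de; have [te he] := ht _ (edge_act e de).
  rewrite /= symm_cellE -te -he /= act_cellK // -(co_tail cd de) -(co_head cd de).
  by [].
- by rewrite /= -eN -eS /= -(co_N cd) -(co_S cd).
- by rewrite /= -e1 -e2 /= -(co_WE cd) -(co_EW cd) -!map_comp.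
- rewrite (co_W cd) (co_E cd) !image_bigcup.
  have imE (P P' : cubecell -> bool) : (forall c, P' (act_cell g c) = P c) ->
      \bigcup_(c in [set c | P (to_triple (phi c))]) ((symm_map g \o h) @` carrier U c) =
      \bigcup_(b in [set b | P' (to_triple b)]) carrier Q b.
    move=> PP'; apply/seteqP; split=> x.
      move=> [c Pc]; rewrite im => cx; exists (symm_cell g (phi c)) => //=.
      by rewrite symm_cellE PP'.
    have [psi _ psiK] := bij; move=> [b Pb bx]; exists (psi b); last first.
      by rewrite im psiK.
    by rewrite /= -PP' -symm_cellE [symm_cell _ _]psiK.
  by split; apply: imE => c; have [hW hE] := hc (act_cell g c); rewrite -?hW -?hE /= act_cellK.
Qed.

Lemma equivalent_realize (U : template_data) (h : space U -> space Q) phi d d' :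
  @complex_iso U Q h phi -> encodes (to_triple \o phi) d -> equiv_code d d' ->
  equivalent U (realize d').
Proof.
move=> iso cd /equiv_codeP[k kd [g gs gd]].
move: kd gd => /= [<-|[<-|[<-|[<-|[]]]]] gd.
- by apply: Or41; exact: codes_template_iso iso cd gs gd.
- by apply: Or42; exact: (@codes_template_iso (kappa U) _ _ _ _ _ iso (codes_kappa cd) gs gd).
- by apply: Or43; exact: (@codes_template_iso (rho U) _ _ _ _ _ iso (codes_rho cd) gs gd).
- apply: Or44; exact: (@codes_template_iso (kappa (rho U)) _ _ _ _ _ iso
    (codes_kappa (codes_rho cd)) gs gd).
Qed.

(** Incidence is inclusion in a closure, which the homeomorphism preserves. The induced map [s] on
    labels is thus an automorphism of the face poset, and so a symmetry by [automorphism_symm]. *)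
Lemma template_iso_eq_code (T U : template_data) phi1 phi2 d d' :
  cubical phi1 -> cubical phi2 -> closed (@total T) -> closed (@total U) ->
  @encodes T phi1 d -> @encodes U phi2 d' -> template_iso T U ->
  exists2 g, g \in symms & eq_code (act_code g d) d'.
Proof.
move=> H1 H2 cl1 cl2 cd cd' [h [phi [iso ends [pN pS] [pWE pEW] [hW hE]]]].
have [hom bij dims im] := iso.
have [psi phiK psiK] := cub_bij H1.
pose s := phi2 \o phi \o psi.
have s_bij : bijective s.
  by apply: bij_comp; [apply: bij_comp; [exact: cub_bij H2|exact: bij]|exists phi1].
have s_dim c : dim_cell (s c) = dim_cell c.
  by rewrite /s /= -(cub_dim H2) dims (cub_dim H1) psiK.
have s_le b c : le_cell (s b) (s c) = le_cell b c.
  have e1 := sub_closure H2 (phi (psi b)) (phi (psi c)).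
  have e2 := sub_closure H1 (psi b) (psi c); rewrite !psiK in e2.
  have [[h' [hh' h'h _ _]] _ _ _] := iso.
  apply/idP/idP => [/e1 sub|/e2 sub].
    apply/e2 => x bx; have : closure (carrier U (phi (psi c))) (h x).
      by apply: sub; rewrite -im; exists x.
    rewrite -(iso_closure iso) // => -[y cy hyx].
    have Ty : total y.
      by move/closure_id: cl1 => ->; apply: closureS cy => z cz; exists (psi c).
    have Tx : total x by exists (psi b).
    by have [_ <-] := hh' _ Tx; rewrite -hyx; have [_ ->] := hh' _ Ty.
  by apply/e1; rewrite -(iso_closure iso) // -im; apply: image_subset.
have [g gs sg] := automorphism_symm s_bij s_dim s_le.
have sE c : phi2 (phi c) = act_cell g (phi1 c) by rewrite -sg /s /= phiK.
(* Equal unions of cells have equal sets of labels by [cup_inj], so an equality of hemispheres as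
   point sets becomes one of colourings. *)
have hemi_eq (P P' : cubecell -> bool) :
    h @` (\bigcup_(c in [set c | P (phi1 c)]) carrier T c) =
    \bigcup_(c in [set c | P' (phi2 c)]) carrier U c ->
    forall c, P (act_cell (symm_inv g) c) = P' c.
  rewrite image_bigcup => e k; have [c ck] := cub_surj H1 (act_cell (symm_inv g) k).
  have [phi' phiK' phi'K] := bij.
  have : [set b | P (phi1 (phi' b))] = [set b | P' (phi2 b)].
    apply: (cup_inj H2); rewrite -e; apply/seteqP; split=> x.
      by move=> [b Pb bx]; exists (phi' b) => //; rewrite im phi'K.
    by move=> [b Pb]; rewrite im => bx; exists (phi b); rewrite /= ?phiK'.
  move=> /(congr1 (fun S : set (cell U) => S (phi c))) /=.
  rewrite phiK' sE ck act_cellKV // => eqP.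
  by apply/idP/idP; rewrite eqP.
exists g => //; apply/eq_codeP; split.
- by rewrite /= -(co_N cd) -(co_S cd) -(co_N cd') -(co_S cd') -pN -pS !sE.
- rewrite /= -(co_WE cd) -(co_EW cd) -(co_WE cd') -(co_EW cd') -pWE -pEW -!map_comp.
  by split; apply: eq_map => c /=; rewrite sE.
- move=> k kk; have [c ck] := cub_surj H1 (act_cell (symm_inv g) k).
  have dc : dim T c = 1.
    by apply/eqP; rewrite (cub_dim H1) ck -(dim_act_cell gs) act_cellKV // -mem_edges.
  have k2 : phi2 (phi c) = k by rewrite sE ck act_cellKV.
  have dpc : dim U (phi c) = 1 by rewrite dims.
  rewrite /= -ck -(co_tail cd dc) -(co_head cd dc) -k2 -(co_tail cd' dpc) -(co_head cd' dpc).
  by have [-> ->] := ends _ dc; rewrite !sE.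
- move=> k; split; apply: hemi_eq.
    by rewrite -(co_W cd) -(co_W cd').
  by rewrite -(co_E cd) -(co_E cd').
Qed.

Lemma equivalent_equiv_code d d' : equivalent (realize d) (realize d') -> equiv_code d d'.
Proof.
have H := cube_cubical R; have cl := @cube_total_closed R.
have c1 := realize_codes d; have c2 := realize_codes d'.
move=> E; apply/equiv_codeP; case: E => E.
- have [g gs gd] := @template_iso_eq_code (realize d) (realize d') _ _ _ _ H H cl cl c1 c2 E.
  by exists d; [left|exists g].
- have [g gs gd] := @template_iso_eq_code (kappa (realize d)) (realize d')
    _ _ _ _ H H cl cl (codes_kappa c1) c2 E.
  by exists (kappa_code d); [right; left|exists g].
- have [g gs gd] := @template_iso_eq_code (rho (realize d)) (realize d')
    _ _ _ _ H H cl cl (codes_rho c1) c2 E.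
  by exists (rho_code d); [right; right; left|exists g].
- have [g gs gd] := @template_iso_eq_code (kappa (rho (realize d))) (realize d')
    _ _ _ _ H H cl cl (codes_kappa (codes_rho c1)) c2 E.
  by exists (kappa_code (rho_code d)); [do 3!right; left|exists g].
Qed.
End Realization.

(** * Pole distance and face counts *)

Section Counting.
Variables (T : template_data) (phi : cell T -> cubecell) (d : code).
Hypothesis H : cubical phi.
Hypothesis D : encodes phi d.

Lemma face_count_codes (h : cubecell -> bool) (W : set (space T)) :
  W = \bigcup_(c in [set c | h (phi c)]) carrier T c ->
  face_count W = count h faces.
Proof.
move=> WE; rewrite /face_count -(fintype.card_image (cub_inj H)) -size_filter.
have /card_uniqP <- : uniq [seq f <- faces | h f] by rewrite filter_uniq.
apply: eq_card => k; rewrite mem_filter mem_faces.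
apply/fintype.imageP/andP => [[c /andP[/eqP dc /asboolP cW] ->]|[hk /eqP dk]].
  by rewrite -(cub_dim H) dc; split=> //; move: cW; rewrite WE (sub_cup H).
have [c ck] := cub_surj H k; exists c => //; rewrite inE (cub_dim H) ck dk eqxx /=.
by apply/asboolP; rewrite WE (sub_cup H) /= ck.
Qed.

Lemma dipath_walk u p v : dipath u p v -> @edge_walk T u v (size p).
Proof.
move=> dp; exists (map (ehead T) p); rewrite size_map; split=> //.
  elim: p u dp => //= e p IH u /and3P[de te /IH ->]; rewrite andbT; apply/orP; left.
  by apply/existsP; exists e; rewrite de te eqxx.
by elim: p u dp => [|e p IH] u /= => [/eqP|/and3P[_ _ /IH]].
Qed.

(** A function that changes by at most 1 along each edge certifies a lower bound on the length of
    all walks. *)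
Lemma walk_potential (f : cubecell -> nat) u v n :
  (forall e, e \in edges -> f (ctail d e) <= (f (chead d e)).+1 /\
                            f (chead d e) <= (f (ctail d e)).+1) ->
  @edge_walk T u v n -> f (phi u) <= f (phi v) + n.
Proof.
move=> fE [p [pu <- <-]]; elim: p u pu => [|x p IH] u /=; first by rewrite addn0.
move=> /andP[ux /IH le]; rewrite addnS -addSn; apply: leq_trans (_ : (f (phi x)).+1 <= _).
  by move: ux; rewrite !(arc_codes H D) => /orP[] /hasP[e /fE[h1 h2] /andP[/eqP <- /eqP <-]].
by rewrite addSn ltnS.
Qed.
End Counting.

(** On vertices this is the edge distance in the cube; it is the potential for [walk_potential]. *)
Definition hamming (c d : cubecell) : nat :=
  (c.1.1 != d.1.1) + (c.1.2 != d.1.2) + (c.2 != d.2).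

(** In all seven codes the shorter meridian is a shortest walk between the poles: its length bounds
    the pole distance from above, and the Hamming distance bounds it from below. *)
Definition measured (d : code) (delta et : nat) : bool :=
  [&& minn (size (cWE d)) (size (cEW d)) == delta,
      hamming (cnorth d) (csouth d) == delta,
      all (fun e => (hamming (ctail d e) (csouth d) <= (hamming (chead d e) (csouth d)).+1) &&
        (hamming (chead d e) (csouth d) <= (hamming (ctail d e) (csouth d)).+1)) edges &
      minn (count (cW d) faces) (count (cE d) faces) == et].

Lemma reps_measured (i : nat) d0 : i < 7 ->
  measured (nth d0 reps i) (nth 0 [:: 1; 1; 1; 2; 2; 2; 3] i)
           (nth 0 [:: 1; 1; 1; 1; 1; 2; 3] i).
Proof.
have chk : all (fun i => measured (nth d0 reps i)
   (nth 0 [:: 1; 1; 1; 2; 2; 2; 3] i) (nth 0 [:: 1; 1; 1; 1; 1; 2; 3] i)) (iota 0 7).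
  by vm_compute.
move=> i7; have mi : i \in iota 0 7 by rewrite mem_iota.
exact: allP chk _ mi.
Qed.

Lemma vertex_to_corner v : v \in vertices -> exists2 g, g \in symms & act_cell g v = corner.
Proof.
have chk : all (fun v => has (fun g => eq_cell (act_cell g v) corner) symms) vertices.
  by vm_compute.
by move=> /(allP chk)/hasP[g gs /eq_cellP]; exists g.
Qed.

Theorem mainTheorem4 (R : realType) :
  exists T : 'I_7 -> template_data,
  [/\ forall i : 'I_7, is_3cell_template R (T i) /\ is_solid_cube R (T i),
      forall i j : 'I_7, equivalent (T i) (T j) -> i = j,
      forall U : template_data, is_3cell_template R U -> is_solid_cube R U ->
        exists i : 'I_7, equivalent U (T i) &
      forall i : 'I_7,
        pole_distance (T i) (nth 0 [:: 1; 1; 1; 2; 2; 2; 3] i)%N /\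
        eta (T i) = (nth 0 [:: 1; 1; 1; 1; 1; 2; 3] i)%N].
Proof.
pose d0 := Code id id corner corner [::] [::] xpredT xpredT.
have H := cube_cubical R.
have tplP (i : 'I_7) : is_3cell_template R (realize R (nth d0 reps i)).
  apply: (@good_code_template (realize R (nth d0 reps i)) _ _ H (realize_codes R _)).
    exact: cube_regular.
  exact: (all_nthP d0 reps_good i (ltn_ord i)).
exists (fun i : 'I_7 => realize R (nth d0 reps i)); split.
- move=> i; split=> //.
  exists id, id; split=> //; last by move=> c; rewrite image_id.
    exists id; split=> //; apply: continuous_subspaceT => x; exact: cvg_id.
  by exists id.
- move=> i j /equivalent_equiv_code ij; apply: val_inj.
  exact: reps_distinct (ltn_ord i) (ltn_ord j) ij.
- move=> U tpl [h [phi iso]].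
  (* The union of the cells of [U] is the closure of its 3-cell. *)
  have clU : closed (@total U).
    by have [_ [B [[_ <-] _ _ _ _]]] := tpl; exact: closed_closure.
  have clQ := @cube_total_closed R.
  have HU := iso_cubical iso clU clQ H.
  have [_ [_ [_ [[_ _ /(_ (north U)) [_ /(_ erefl) [dN _]] _] _ _ _] _ _ _]]] := tpl.
  (* Composing the given isomorphism with a symmetry of the cube puts the North pole at [corner], as
     the enumeration requires. *)
  have [g gs gN] : exists2 g, g \in symms & act_cell g (to_triple (phi (north U))) = corner.
    apply: vertex_to_corner.
    by rewrite mem_vertices -[to_triple _]/((to_triple \o phi) _) -(cub_dim HU) dN.
  have iso' := complex_iso_comp iso (symm_iso R gs).
  have HU' := iso_cubical iso' clU clQ H.
  have [|d cd] := template_code HU' tpl.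
    by rewrite /= /symm_cell of_tripleK.
  move=> /(has_nthP d0)[i i7 eq]; exists (Ordinal (i7 : i < 7)).
  exact: equivalent_realize iso' cd eq.
- move=> i; have cd := realize_codes R (nth d0 reps i).
  have [_ [_ [_ [_ pWE pEW _] _ _ _]]] := tplP i.
  pose Ti := realize R (nth d0 reps i).
  have /and4P[/eqP len /eqP ham /allP pot /eqP cnt] := reps_measured d0 (ltn_ord i).
  split; last first.
    by rewrite /eta (@face_count_codes Ti _ H _ _ (co_W cd)) (@face_count_codes Ti _ H _ _ (co_E cd)).
  split.
    rewrite -len /minn -!(size_map of_triple (cWE _)) -(size_map of_triple (cEW _)).
    by case: ifP => _; [exact: dipath_walk pWE|exact: dipath_walk pEW].
  (* The distance to the South pole vanishes there and equals the claimed value at the North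
     pole. *)
  move=> m /(@walk_potential Ti _ _ H cd (fun c => hamming c (csouth (nth d0 reps i)))).
  rewrite (co_N cd) (co_S cd) ham => le; apply: leq_trans (le _) _.
    by move=> e /pot/andP[].
  by rewrite /hamming !eqxx.
Qed.
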